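(* Let $p$ be a prime, $k>0$ an integer, and $G_{p,k}=C_{p^\infty}\times C_k\times\mathbf{T}$. Let $\mathcal{C}^{dis}\subset\mathcal{C}(G_{p,k})$ be the set of infinite discrete subgroups of $G_{p,k}$ and $\mathcal{C}^{fin}(C_k\times\mathbf{T})\subset\mathcal{C}(C_k\times\mathbf{T})$ the set of finite subgroups of $C_k\times\mathbf{T}$, both with the subspace topology of the respective Chabauty spaces. For $F\in\mathcal{C}^{fin}(C_k\times\mathbf{T})$ and $f\in\widehat{C_{p^\infty}}$, let $H_{F,f}=q_F^{-1}(\mathrm{Graph}(\iota_F\circ f))$. Then: (1) the map $\alpha:\mathcal{C}^{fin}(C_k\times\mathbf{T})\times\widehat{C_{p^\infty}}\to\mathcal{C}^{dis}$, $(F,f)\mapsto H_{F,f}$, is a well-defined homeomorphism; (2) the closure of $\mathcal{C}^{dis}$ in $\mathcal{C}(G_{p,k})$ is the union of $\mathcal{C}^{dis}$ with the $d(k)$ subgroups $C_{p^\infty}\times C_d\times\mathbf{T}$, $d$ a positive divisor of $k$.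
   Context: $\mathbf{T}$ is the circle group; $C_m\subset\mathbf{T}$ is the group of $m$-th roots of unity; $C_{p^\infty}=\bigcup_{\ell\ge1}C_{p^\ell}$ is the Prüfer $p$-group, with the discrete topology; $\widehat{C_{p^\infty}}=\mathrm{Hom}(C_{p^\infty},\mathbf{T})$ is its Pontryagin dual (a compact group). For a locally compact group $G$, $\mathcal{C}(G)$ is the set of closed subgroups of $G$ with the Chabauty topology, generated by the sets $\{H: H\cap K=\emptyset\}$ ($K$ compact) and $\{H:H\cap U\ne\emptyset\}$ ($U$ open). For a finite subgroup $F$ of $C_k\times\mathbf{T}$, $q_F:G_{p,k}\to G_{p,k}/(\{1\}\times F)=C_{p^\infty}\times (C_k\times\mathbf{T})/F$ is the quotient map; $T^0_F$ denotes the identity component of the 1-dimensional compact abelian Lie group $(C_k\times\mathbf{T})/F$, an identification $T^0_F\simeq\mathbf{T}$ is fixed, and $\iota_F:\mathbf{T}\simeq T^0_F\hookrightarrow (C_k\times\mathbf{T})/F$ is the resulting inclusion. $\mathrm{Graph}(g)=\{(w,g(w)):w\in C_{p^\infty}\}$. $d(k)$ is the number of positive divisors of $k$. *)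

(* Defs.v *)
From HB Require Import structures.
From mathcomp Require Import all_boot all_order all_algebra.
From mathcomp Require Import all_classical all_reals all_analysis.
Set Implicit Arguments. Unset Strict Implicit. Unset Printing Implicit Defensive.
Import Order.TTheory GRing.Theory Num.Theory.
Import numFieldNormedType.Exports.
Local Open Scope classical_set_scope.
Local Open Scope ring_scope.

Section GenTop.
Variable X : Type.

Definition topology_on (tau : set (set X)) : Prop :=
  [/\ tau setT,
      (forall U V, tau U -> tau V -> tau (U `&` V)) &
      (forall (I : Type) (F : I -> set X),
          (forall i, tau (F i)) -> tau (\bigcup_(i in setT) F i))].

Definition gen_top (B : set (set X)) : set (set X) :=
  fun U => forall tau, topology_on tau -> B `<=` tau -> tau U.

Definition sopen (A : set X) (tau : set (set X)) (V : set X) : Prop :=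
  exists U, tau U /\ V = U `&` A.

Definition closed_in (A : set X) (tau : set (set X)) (H : set X) : Prop :=
  H `<=` A /\ sopen A tau (A `\` H).

Definition compact_in (A : set X) (tau : set (set X)) (K : set X) : Prop :=
  K `<=` A /\
  forall (I : Type) (F : I -> set X), (forall i, tau (F i)) ->
    K `<=` \bigcup_(i in setT) F i ->
    exists J : set I, finite_set J /\ K `<=` \bigcup_(i in J) F i.

Definition connected_in (A : set X) (tau : set (set X)) (S : set X) : Prop :=
  S `<=` A /\
  ~ (exists U V, tau U /\ tau V /\ S `<=` U `|` V /\ S `&` U !=set0 /\
                 S `&` V !=set0 /\ S `&` U `&` V = set0).

Definition component (A : set X) (tau : set (set X)) (x : X) : set X :=
  [set y | exists S, connected_in A tau S /\ S x /\ S y].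

Definition closure_in (A : set X) (tau : set (set X)) (S : set X) : set X :=
  [set x | A x /\ forall U, tau U -> U x -> exists y, S y /\ U y].

Definition disc_top : set (set X) := setT.
Arguments disc_top : clear implicits.

Variables (mul : X -> X -> X) (inv : X -> X) (one : X).

Definition is_subgroup (A : set X) (H : set X) : Prop :=
  [/\ H `<=` A, H one & forall x y, H x -> H y -> H (mul x (inv y))].

Definition closed_subgroups (A : set X) (tau : set (set X)) : set (set X) :=
  [set H | closed_in A tau H /\ is_subgroup A H].

Definition coset (H : set X) (x : X) : set X := [set mul x h | h in H].

Definition setmul (P Q : set X) : set X := [set mul x y | x in P & y in Q].

End GenTop.

Definition chabauty {X : Type} (A : set X) (tau : set (set X))
  : set (set (set X)) :=
  gen_top (fun O =>
    (exists K, compact_in A tau K /\ O = [set H | H `&` K = set0]) \/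
    (exists U, tau U /\ O = [set H | H `&` U !=set0])).

Definition prod_top {X Y : Type} (t1 : set (set X)) (t2 : set (set Y))
  : set (set (X * Y)) :=
  gen_top (fun W => exists U V, t1 U /\ t2 V /\ W = U `*` V).

Definition homeo {X Y : Type} (A : set X) (tX : set (set X))
  (B : set Y) (tY : set (set Y)) (h : X -> Y) : Prop :=
  [/\ forall x, A x -> B (h x),
      forall x y, A x -> A y -> h x = h y -> x = y,
      forall y, B y -> exists2 x, A x & h x = y,
      (forall V, tY V -> exists U, tX U /\ A `&` h @^-1` V = A `&` U) &
      (forall U, tX U -> exists V, tY V /\ h @` (A `&` U) = B `&` V)].

Notation R2_ R := (R * R)%type (only parsing).
Section Circle.
Variable R : realType.
Local Notation R2 := (R2_ R).

Definition cmul (z w : R2) : R2 := (z.1 * w.1 - z.2 * w.2, z.1 * w.2 + z.2 * w.1).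
Definition cinv (z : R2) : R2 := (z.1, - z.2).
Definition cone : R2 := (1, 0).
Definition cpow (z : R2) (n : nat) : R2 := iter n (cmul z) cone.

Definition Tc : set R2 := [set z | z.1 ^+ 2 + z.2 ^+ 2 = 1].
Definition tauR2 : set (set R2) := [set U : set R2 | open U].

Definition rootsU (m : nat) : set R2 := [set z | Tc z /\ cpow z m = cone].

Definition Cpinf (p : nat) : set R2 := [set z | exists l : nat, rootsU (p ^ l.+1) z].

Definition hmul (x y : R2 * R2) : R2 * R2 := (cmul x.1 y.1, cmul x.2 y.2).
Definition hinv (x : R2 * R2) : R2 * R2 := (cinv x.1, cinv x.2).
Definition hone : R2 * R2 := (cone, cone).
Definition CkT (k : nat) : set (R2 * R2) := rootsU k `*` Tc.
(* C_k and T carry subspace topologies of R^2 (given through ambient opens) *)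
Definition tauCkT : set (set (R2 * R2)) := prod_top tauR2 tauR2.

Definition Cfin (k : nat) : set (set (R2 * R2)) :=
  [set F | closed_subgroups hmul hinv hone (CkT k) tauCkT F /\ finite_set F].

Definition G3 := (R2 * R2 * R2)%type.
Definition gmul (x y : G3) : G3 :=
  (cmul x.1.1 y.1.1, cmul x.1.2 y.1.2, cmul x.2 y.2).
Definition ginv (x : G3) : G3 := (cinv x.1.1, cinv x.1.2, cinv x.2).
Definition gone : G3 := (cone, cone, cone).
Definition Gpk (p k : nat) : set G3 := Cpinf p `*` rootsU k `*` Tc.
Definition tauG : set (set G3) := prod_top (prod_top (@disc_top R2) tauR2) tauR2.

Definition CG (p k : nat) : set (set G3) := closed_subgroups gmul ginv gone (Gpk p k) tauG.

Definition Cdis (p k : nat) : set (set G3) :=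
  [set H | CG p k H /\ ~ finite_set H /\
           forall h, H h -> exists U, tauG U /\ U `&` H = [set h]].

(* ---- Pontryagin dual of C_{p^oo}: homomorphisms C_{p^oo} -> T
   (all continuous, the source being discrete).  Functions are normalised
   to take the value 1 outside C_{p^oo}. Compact-open topology. ---- *)
Definition dual (p : nat) : set (R2 -> R2) :=
  [set f | (forall w, Cpinf p w -> Tc (f w)) /\
           (forall w v, Cpinf p w -> Cpinf p v -> f (cmul w v) = cmul (f w) (f v)) /\
           (forall w, ~ Cpinf p w -> f w = cone)].
Definition dual_top (p : nat) : set (set (R2 -> R2)) :=
  gen_top (fun O => exists K U, compact_in (Cpinf p) (@disc_top R2) K /\ tauR2 U /\
                     O = [set f | forall w, K w -> U (f w)]).

Definition quot (k : nat) (F : set (R2 * R2)) : set (set (R2 * R2)) :=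
  [set Q | exists x, CkT k x /\ Q = coset hmul F x].
Definition quot_top (k : nat) (F : set (R2 * R2)) : set (set (set (R2 * R2))) :=
  [set O | sopen (CkT k) tauCkT (\bigcup_(Q in O `&` quot k F) Q)].
Definition T0 (k : nat) (F : set (R2 * R2)) : set (set (R2 * R2)) :=
  component (quot k F) (quot_top k F) F.

Definition identification (k : nat) (F : set (R2 * R2)) (iota : R2 -> set (R2 * R2)) : Prop :=
  homeo Tc tauR2 (T0 k F) (quot_top k F) iota /\
  forall a b, Tc a -> Tc b -> iota (cmul a b) = setmul hmul (iota a) (iota b).

Definition Hff (p k : nat) (iota : set (R2 * R2) -> R2 -> set (R2 * R2))
  (F : set (R2 * R2)) (f : R2 -> R2) : set G3 :=
  [set g | Gpk p k g /\ coset hmul F (g.1.2, g.2) = iota F (f g.1.1)].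

End Circle.

(* Main.v *)
Require Import Defs.
From HB Require Import structures.
From mathcomp Require Import all_boot all_order all_algebra.
From mathcomp Require Import all_classical all_reals all_analysis.
From mathcomp Require Import cyclic separable cyclotomic complex finmap.
From mathcomp Require Import ring lra.
Set Implicit Arguments. Unset Strict Implicit. Unset Printing Implicit Defensive.
Import Order.TTheory GRing.Theory Num.Theory.
Import numFieldNormedType.Exports.
Local Open Scope classical_set_scope.
Local Open Scope ring_scope.

(** Let [H] be an infinite discrete subgroup of [G_{p,k}].  Its slice [F] over [1] is discrete and
    closed in the compact group [C_k x T], hence finite; its projection to [C_{p^oo}] is an infinite
    subgroup, hence everything.  So [H] is the preimage of the graph of a homomorphism from
    [C_{p^oo}] to [(C_k x T) / F]; writing an element of [C_{p^oo}] as a [k]-th power shows that its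
    image is the class of some [(1, t)], which lies in the identity component.  This inverts
    [alpha].

    Finite subgroups of [C_k x T] are isolated in the Chabauty topology because the circle has no
    small subgroups, and [H |-> F] is Chabauty-continuous because [{1} x C_k x T] is open and
    compact.  Hence [F] is locally constant on both sides, and for fixed [F] a Chabauty
    neighbourhood of [H_{F,f}] constrains [f] on finitely many points only, as does a
    neighbourhood of [f] in the dual.

    A limit [H] of discrete subgroups still projects onto [C_{p^oo}].  If its slice over [1] is
    finite, [H] is discrete; otherwise the slice contains [1 x T], and divisibility of [C_{p^oo}]
    forces [H = C_{p^oo} x C_d x T].  The latter is the limit of [C_{p^oo} x C_d x C_{n!}]. *)

Local Arguments cpow {R} z n%_N.
Local Arguments rootsU {R} m%_N.

(** * Roots of unity and the Prüfer group *)

Section Roots.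
Variable R : realType.
Implicit Types (z w v : R2_ R) (n m : nat) (P : set (R2_ R)).

(** Passage to the field [R[i]] turns [cmul] into the field product, so ring laws and the theory of
    primitive roots over an algebraically closed field apply to pairs. *)
Definition toC z : R[i] := (z.1 +i* z.2)%C.

Lemma toC_inj : injective toC.
Proof. by case=> a b [c d] []/= -> ->. Qed.

Lemma toCM z w : toC (cmul z w) = toC z * toC w.
Proof. by []. Qed.

Lemma toC1 : toC (cone R) = 1.
Proof. by []. Qed.

Lemma toCX z n : toC (cpow z n) = toC z ^+ n.
Proof. by elim: n => [|n IH]//; rewrite exprS -IH. Qed.

Lemma toC_surj (c : R[i]) : exists z, toC z = c.
Proof. by case: c => a b; exists (a, b). Qed.

Lemma cmulA z w v : cmul z (cmul w v) = cmul (cmul z w) v.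
Proof. by apply: toC_inj; rewrite !toCM mulrA. Qed.

Lemma cmulC z w : cmul z w = cmul w z.
Proof. by apply: toC_inj; rewrite !toCM mulrC. Qed.

Lemma cmul1 z : cmul (cone R) z = z.
Proof. by apply: toC_inj; rewrite !toCM mul1r. Qed.

Lemma cmulr1 z : cmul z (cone R) = z.
Proof. by rewrite cmulC cmul1. Qed.

Lemma cmulV z : Tc z -> cmul z (cinv z) = cone R.
Proof.
case: z => a b; rewrite /Tc/= => h; rewrite /cmul/cinv/cone/=; congr pair; last by ring.
by rewrite -h; ring.
Qed.

Lemma Tc1 : Tc (cone R).
Proof. by rewrite /Tc/cone/= expr0n/= addr0 expr1n. Qed.

Lemma TcM z w : Tc z -> Tc w -> Tc (cmul z w).
Proof.
rewrite /Tc/= => hz hw; transitivity ((z.1 ^+ 2 + z.2 ^+ 2) * (w.1 ^+ 2 + w.2 ^+ 2)); first ring.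
by rewrite hz hw mulr1.
Qed.

Lemma TcV z : Tc z -> Tc (cinv z).
Proof. by rewrite /Tc/= sqrrN. Qed.

Lemma TcX z n : Tc z -> Tc (cpow z n).
Proof. by move=> hz; elim: n => [|n IH]; [exact: Tc1 | exact: TcM]. Qed.

Lemma cpowE z n : cpow z n.+1 = cmul z (cpow z n).
Proof. by []. Qed.

Lemma cpow1n n : cpow (cone R) n = cone R.
Proof. by apply: toC_inj; rewrite toCX toC1 expr1n. Qed.

Lemma cpowM z n m : cpow z (n * m) = cpow (cpow z n) m.
Proof. by apply: toC_inj; rewrite !toCX exprM. Qed.

Lemma cpowMn z w n : cpow (cmul z w) n = cmul (cpow z n) (cpow w n).
Proof. by apply: toC_inj; rewrite !(toCX, toCM) exprMn. Qed.

Lemma cpow_inv z n : Tc z -> cpow (cinv z) n = cinv (cpow z n).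
Proof.
move=> hz; have hX := TcX n hz.
rewrite -[LHS]cmulr1 -(cmulV hX) cmulA -cpowMn [cmul (cinv z) z]cmulC cmulV//.
by rewrite cpow1n cmul1.
Qed.

Lemma cinv1 : cinv (cone R) = cone R.
Proof. by rewrite /cinv/cone/= oppr0. Qed.

(** Membership in the circle comes for free: a complex number with an [n]-th power equal to 1,
    [n > 0], has modulus 1. *)
Lemma rootsUP n z : (0 < n)%N -> rootsU n z <-> toC z ^+ n = 1.
Proof.
move=> n0; split=> [[_ h]|h]; first by rewrite -toCX h.
split; last by apply: toC_inj; rewrite toCX.
have : `|toC z| ^+ n = 1 by rewrite -normrX h normr1.
move/eqP; rewrite pexpr_eq1// => /eqP; rewrite normc_def => -[] /(congr1 (fun x => x ^+ 2)).
by rewrite sqr_sqrtr ?expr1n// addr_ge0 ?sqr_ge0.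
Qed.

Lemma rootsU_dvd n m : (n %| m)%N -> @rootsU R n `<=` rootsU m.
Proof.
case/dvdnP=> q -> z [hz h]; split=> //; by rewrite mulnC cpowM h cpow1n.
Qed.

Lemma rootsU1 n : rootsU n (cone R).
Proof. by split; [exact: Tc1 | rewrite cpow1n]. Qed.

Lemma rootsUM n z w : rootsU n z -> rootsU n w -> rootsU n (cmul z w).
Proof. by move=> [h1 h2] [h3 h4]; split; [exact: TcM | rewrite cpowMn h2 h4 cmul1]. Qed.

Lemma rootsUV n z : rootsU n z -> rootsU n (cinv z).
Proof. by move=> [h1 h2]; split; [exact: TcV | rewrite cpow_inv// h2 cinv1]. Qed.

(** Over the algebraically closed field [R[i]] the polynomial [X^n - 1] splits, and it is separable
    in characteristic 0; among its [n] distinct roots one is primitive. *)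
Lemma prim_root_exists n : (0 < n)%N -> exists z, n.-primitive_root (toC z).
Proof.
move=> n0; have [r Dp] := closed_field_poly_normal ('X^n - 1 : {poly R[i]}).
rewrite (monicP _) ?monicXnsubC // scale1r in Dp.
have rn1: all n.-unity_root r by apply/allP=> z; rewrite -root_prod_XsubC -Dp.
have sz_r: (n < (size r).+1)%N.
  by rewrite -(size_prod_XsubC r id) -Dp size_XnsubC.
have [|c _ hc] := hasP (has_prim_root n0 rn1 _ sz_r).
  by rewrite -separable_prod_XsubC -Dp separable_Xn_sub_1 // pnatr_eq0 -lt0n.
by have [z hz] := toC_surj c; exists z; rewrite hz.
Qed.

Lemma rootsU_finite n : (0 < n)%N -> finite_set (@rootsU R n).
Proof.
move=> n0; have [z hz] := prim_root_exists n0.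
apply: (@sub_finite_set _ _ [set cpow z i | i in `I_n]); last by apply: finite_image; exact: finite_II.
move=> w /(rootsUP w n0) /(prim_rootP hz) [i hi]; exists i; first exact: (ltn_ord i).
by apply: toC_inj; rewrite toCX.
Qed.

(** Let [g] be a primitive [k]-th root and [m] the least positive exponent with [g^m] in [P].
    Euclidean division shows that [m] divides every exponent of an element of [P], so [P] is
    generated by [g^m], of order [k / m]. *)
Lemma subgroup_rootsU k P : (0 < k)%N -> P `<=` rootsU k -> P (cone R) ->
  (forall z w, P z -> P w -> P (cmul z (cinv w))) ->
  exists d, [/\ (1 <= d)%N, (d %| k)%N & P = rootsU d].
Proof.
move=> k0 Pk P1 PM.
have PV z : P z -> P (cinv z) by move=> hz; rewrite -[cinv z]cmul1; exact: PM.
have Pmul z w : P z -> P w -> P (cmul z w).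
  by move=> hz hw; have := PM _ _ hz (PV _ hw); rewrite /cinv/= opprK -surjective_pairing.
have PX z n : P z -> P (cpow z n).
  by move=> hz; elim: n => [//|n IH]; exact: Pmul.
have [g hg] := prim_root_exists k0.
have gk : cpow g k = cone R by apply: toC_inj; rewrite toCX prim_expr_order.
have ex : exists n, (0 < n)%N && `[<P (cpow g n)>].
  by exists k; rewrite k0/=; apply/asboolP; rewrite gk.
case: (ex_minnP ex) => m /andP[m0 /asboolP Pm] minm.
have [gT _] := (rootsUP g k0).2 (prim_expr_order hg).
have Pdvd n : P (cpow g n) -> (m %| n)%N.
  move=> Pn; case: (posnP (n %% m)) => [/eqP//|r0].
  suff : (m <= n %% m)%N by rewrite leqNgt ltn_mod m0.
  apply: minm; rewrite r0/=; apply/asboolP.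
  have := PM _ _ Pn (PX _ (n %/ m)%N Pm).
  rewrite -cpowM; congr P.
  have hX := TcX (m * (n %/ m))%N gT.
  have -> : cpow g n = cmul (cpow g (n %% m)) (cpow g (m * (n %/ m))).
    by apply: toC_inj; rewrite toCM !toCX -exprD addnC mulnC -divn_eq.
  by rewrite -cmulA cmulV// cmulr1.
have mk : (m %| k)%N by apply: Pdvd; rewrite gk.
have d0 : (0 < k %/ m)%N by rewrite divn_gt0// dvdn_leq.
exists (k %/ m)%N; split=> //; first by rewrite dvdn_div.
apply/seteqP; split=> z.
  move=> Pz; have /(rootsUP z k0) /(prim_rootP hg) [i hi] := Pk _ Pz.
  have E : z = cpow g i by apply: toC_inj; rewrite toCX.
  move: Pz; rewrite E => /Pdvd/dvdnP[q ->]; split; first exact: TcX.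
  by rewrite -cpowM -mulnA [(m * _)%N]mulnC divnK// mulnC cpowM gk cpow1n.
move=> zd; have /(rootsUP z k0) /(prim_rootP hg) [i hi] := rootsU_dvd (dvdn_div mk) zd.
have E : z = cpow g i by apply: toC_inj; rewrite toCX.
(* Here [g^(i (k/m)) = 1], so [k = (k/m) m] divides [i (k/m)], that is, [m] divides [i]. *)
case: zd => _; rewrite E -cpowM => /(congr1 toC); rewrite toCX toC1 => /eqP.
rewrite -(prim_order_dvd hg) -{1}(divnK mk) mulnC dvdn_pmul2r// => /dvdnP[q ->].
by rewrite mulnC cpowM; exact: PX.
Qed.

(** * The Prüfer group: divisibility and infinite subgroups *)

Section Prufer.
Variables (p : nat) (hp : prime p).
Let p0 l : (0 < p ^ l)%N. Proof. by rewrite expn_gt0 prime_gt0. Qed.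

Lemma Cpinf_Tc z : Cpinf p z -> Tc z.
Proof. by case=> l []. Qed.

Lemma Cpinf1 : Cpinf p (cone R).
Proof. by exists 0%N; exact: rootsU1. Qed.

Lemma rootsU_Cpinf l : @rootsU R (p ^ l) `<=` Cpinf p.
Proof. by move=> z hz; exists l; apply: rootsU_dvd hz; rewrite dvdn_exp2l. Qed.

Lemma CpinfM z w : Cpinf p z -> Cpinf p w -> Cpinf p (cmul z w).
Proof.
move=> [l hl] [m hm]; exists (l + m)%N; apply: rootsUM.
  by apply: rootsU_dvd hl; rewrite dvdn_exp2l// ltnS leq_addr.
by apply: rootsU_dvd hm; rewrite dvdn_exp2l// ltnS leq_addl.
Qed.

Lemma CpinfV z : Cpinf p z -> Cpinf p (cinv z).
Proof. by case=> l hl; exists l; exact: rootsUV. Qed.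

Lemma CpinfX z n : Cpinf p z -> Cpinf p (cpow z n).
Proof. by move=> hz; elim: n => [|n IH]; [exact: Cpinf1 | exact: CpinfM]. Qed.

(** Write [k = m p^a] with [m] prime to [p]. A complex [p^a]-th root [v0] of [w] is killed by
    [p^(l+1+a)], and raising it to an inverse [u] of [m] modulo that number gives a [k]-th root of
    [w]. *)
Lemma Cpinf_divisible k w : (0 < k)%N -> Cpinf p w -> exists2 v, Cpinf p v & cpow v k = w.
Proof.
move=> k0 [l hl].
pose a := logn p k; pose m := (k %/ p ^ a)%N.
have km : k = (m * p ^ a)%N by rewrite divnK// pfactor_dvdnn.
have cop : coprime m (p ^ (l.+1 + a)).
  apply: coprimeXr; rewrite coprime_sym prime_coprime// -(@dvdn_pmul2r (p ^ a)%N)// -km -expnS.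
  by rewrite pfactor_dvdn// ltnn.
pose c := (p ^ a)%N.-root (toC w).
have [v0 hv0] := toC_surj c.
have v0E : cpow v0 (p ^ a) = w by apply: toC_inj; rewrite toCX hv0 /c rootCK.
have v0r : cpow v0 (p ^ (l.+1 + a)) = cone R.
  by rewrite addnC expnD cpowM v0E; case: hl.
have v0R : rootsU (p ^ (l.+1 + a)) v0 by apply/rootsUP => //; rewrite -toCX v0r.
have m0 : (0 < m)%N by move: k0; rewrite km muln_gt0 => /andP[].
have [u u' hu _] := egcdnP (p ^ (l.+1 + a))%N m0.
rewrite (eqP cop) in hu.
exists (cpow v0 u); first by apply: CpinfX; apply: rootsU_Cpinf v0R.
rewrite -cpowM km mulnA hu mulnDl mul1n.
apply: toC_inj; rewrite toCX exprD -toCX.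
have -> : (u' * p ^ (l.+1 + a) * p ^ a = p ^ (l.+1 + a) * (u' * p ^ a))%N by ring.
by rewrite cpowM v0r cpow1n toC1 mul1r -toCX v0E.
Qed.

(** A finite subset would lie in a single level [C_{p^l}], which contains no primitive [p^(l+1)]-th
    root of unity. *)
Lemma Cpinf_infinite : infinite_set (@Cpinf R p).
Proof.
move=> fin.
suff [l hl] : exists l, @Cpinf R p `<=` rootsU (p ^ l).
  have [z hz] := prim_root_exists (p0 l.+1).
  have : Cpinf p z by exists l; apply/rootsUP => //; exact: (prim_expr_order hz).
  move=> /hl /(rootsUP _ (p0 l)) /eqP; rewrite -(prim_order_dvd hz) => /dvdn_leq-/(_ (p0 l)).
  by rewrite leq_exp2l ?prime_gt1// ltnn.
suff H (s : seq (R2_ R)) : [set` s] `<=` Cpinf p -> exists l, [set` s] `<=` rootsU (p ^ l).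
  have [s hs] := (finite_seqP _).1 fin; rewrite hs; apply: H; by rewrite -hs.
elim: s => [|x s IH] sub; first by exists 0%N.
have [y ys|l hl] := IH; first by apply: sub; rewrite /= inE ys orbT.
have [|m hm] := sub x; first by rewrite /= inE eqxx.
exists (l + m.+1)%N => y; rewrite /= inE => /orP[/eqP ->|/hl].
  by apply: rootsU_dvd hm; rewrite dvdn_exp2l// leq_addl.
by apply: rootsU_dvd; rewrite dvdn_exp2l// leq_addr.
Qed.

(** Each level is finite, so [P] has an element [v] outside the level of [w]. Its order [p^b] is at
    least [p^(l+1)], and the powers of [v] run through all [p^b]-th roots of unity, [w] included. *)
Lemma infinite_sub_Cpinf P : infinite_set P -> P `<=` Cpinf p -> P (cone R) ->
  (forall z w, P z -> P w -> P (cmul z w)) -> P = Cpinf p.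
Proof.
move=> inf sub P1 PM; apply/seteqP; split=> // w [l hl].
have PX z n : P z -> P (cpow z n).
  by move=> hz; elim: n => [//|n IH]; exact: PM.
have [v [Pv nv]] : exists v, P v /\ ~ rootsU (p ^ l.+1) v.
  apply: contrapT => no; apply: inf; apply: sub_finite_set (rootsU_finite (p0 l.+1)) => v Pv.
  by apply: contrapT => nv; apply: no; exists v.
have [m /(rootsUP _ (p0 _)) hm] := sub _ Pv.
have [a ha] := prim_order_exists (p0 _) hm; case/(dvdn_pfactor _ _ hp)=> b _ ab; subst a.
have lb : (l.+1 <= b)%N.
  rewrite leqNgt; apply/negP => bl; apply: nv; apply/rootsUP => //; apply/eqP.
  by rewrite -(prim_order_dvd ha) dvdn_exp2l// ltnW.
have /(rootsUP _ (p0 _)) hw : rootsU (p ^ b) w by apply: rootsU_dvd hl; rewrite dvdn_exp2l.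
have [i hi] := prim_rootP ha hw.
have -> : w = cpow v i by apply: toC_inj; rewrite toCX.
exact: PX.
Qed.
End Prufer.
End Roots.

(** * Generated topologies and slices *)

Section GeneratedTopology.
Variable X : Type.
Implicit Types (tau B : set (set X)).

Lemma gen_top_topology B : topology_on (gen_top B).
Proof.
split=> [tau []//|U V hU hV tau ht hB|I F hF tau ht hB].
  by case: (ht) => _ + _; apply; [exact: hU | exact: hV].
by case: (ht) => _ _; apply=> i; exact: hF.
Qed.

Lemma sub_gen_top B : B `<=` gen_top B.
Proof. by move=> U BU tau _; apply. Qed.

Lemma topology_local tau U : topology_on tau ->
  (forall x, U x -> exists V, [/\ tau V, V x & V `<=` U]) -> tau U.
Proof.
move=> [_ _ tauU] loc.
have -> : U = \bigcup_(i in @setT {V : set X | tau V /\ V `<=` U}) sval i.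
  apply/seteqP; split=> [x /loc[V [tV Vx VU]]|x [[V [tV VU]] _ /=]]; last exact: VU.
  by exists (exist _ V (conj tV VU)).
by apply: tauU => -[V []].
Qed.

Lemma topology_finite_bigcap (I : eqType) tau (D : set I) (F : I -> set X) :
  topology_on tau -> finite_set D -> (forall i, D i -> tau (F i)) ->
  tau (\bigcap_(i in D) F i).
Proof.
move=> [tauT tauI _] /finite_seqP[s ->]; elim: s => [|i s IH] hF.
  by rewrite (_ : bigcap _ _ = setT)//; apply/seteqP; split.
rewrite (_ : bigcap _ _ = F i `&` \bigcap_(j in [set` s]) F j).
  apply: tauI; first by apply: hF; rewrite /= inE eqxx.
  by apply: IH => j js; apply: hF; rewrite /= inE js orbT.
apply/seteqP; split=> x.
  by move=> h; split=> [|j js]; apply: h; rewrite /= inE ?eqxx// js orbT.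
by move=> [hi h] j; rewrite /= inE => /orP[/eqP->//|]; exact: h.
Qed.

End GeneratedTopology.

Lemma open_topology (T : topologicalType) : topology_on (@open T).
Proof.
split; [exact: openT | exact: openI | move=> I F hF; exact: bigcup_open].
Qed.

Lemma prod_topP (X Y : Type) (tX : set (set X)) (tY : set (set Y)) W :
  topology_on tX -> topology_on tY ->
  prod_top tX tY W <->
  forall z, W z -> exists U V, [/\ tX U, tY V, U z.1, V z.2 & U `*` V `<=` W].
Proof.
move=> topX topY; split=> [hW|loc].
  apply: (hW (fun W => forall z, W z ->
      exists U V, [/\ tX U, tY V, U z.1, V z.2 & U `*` V `<=` W])).
    case: (topX) => XT XI _; case: (topY) => YT YI _; split.
    - by move=> z _; exists setT, setT.
    - move=> W1 W2 h1 h2 z [/h1[U1 [V1 [a b c d e]]] /h2[U2 [V2 [a' b' c' d' e']]]].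
      exists (U1 `&` U2), (V1 `&` V2); split=> //; [exact: XI | exact: YI |].
      by move=> y [[? ?] [? ?]]; split; [exact: e | exact: e'].
    - move=> I F hF z [i _ /hF[U [V [a b c d e]]]]; exists U, V; split=> // y /e ?.
      by exists i.
  by move=> _ [U [V [hU [hV ->]]]] z [Uz Vz]; exists U, V; split=> // ?.
apply: topology_local (gen_top_topology _) _ => z /loc[U [V [a b c d e]]].
by exists (U `*` V); split=> //; apply: sub_gen_top; exists U, V.
Qed.

Lemma compact_finite_subcover (T : topologicalType) (x0 : T) (K : set T) :
  compact K <-> forall (I : Type) (F : I -> set T), (forall i, open (F i)) ->
    K `<=` \bigcup_(i in setT) F i ->
    exists J : set I, finite_set J /\ K `<=` \bigcup_(i in J) F i.
Proof.
(* The point [x0] supplies the pointed structure under which compactness becomes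
   cover-compactness. *)
pose pT : ptopologicalType := HB.pack T (isPointed.Build T x0).
have -> : compact K = @cover_compact T K by exact: (congr1 (fun f => f K) (@compact_cover pT)).
split=> [cK I F oF KF|cK I D f of_ Kf].
  have [|J _ KJ] := cK {classic I} setT F (fun i _ => oF i) _; first exact: KF.
  exists [set` J]; split=> //; exact: (finite_fset J).
(* Building [D i] into the sets removes the restriction on the index: members outside [D] become
   empty. *)
have [i|x /Kf[i Di fx]|J [finJ KJ]] := cK I (fun i x => D i /\ f i x).
- case: (pselect (D i)) => Di.
    rewrite (_ : (fun x => _) = f i); first exact: of_.
    by apply/seteqP; split=> x // [].
  rewrite (_ : (fun x => _) = set0); first exact: open0.
  by apply/seteqP; split=> x // [].
- by exists i.
have finJD : finite_set (J `&` D) by apply: finite_setIl.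
have [X hX] := finite_fsetP.1 finJD.
exists X.
  by move=> i iX; apply: mem_set; have : [set` X] i by []; rewrite -hX => -[].
by move=> x /KJ[i Ji [Di fx]]; exists i => //; rewrite -hX.
Qed.

Lemma continuous_pair (T U V : topologicalType) (f : T -> U) (g : T -> V) x :
  {for x, continuous f} -> {for x, continuous g} -> {for x, continuous (fun y => (f y, g y))}.
Proof. by move=> cf cg; exact: (cvg_pair cf cg). Qed.

(** * Reduction of the topology of [G_{p,k}] to slices *)

Section Transfer.
Variable R : realType.
Local Notation R2 := (R2_ R).
Implicit Types (w : R2) (A K F : set (R2 * R2)) (H U : set (G3 R)).

Lemma tauCkTE : @tauCkT R = @open (R2 * R2)%type.
Proof.
apply/seteqP; split=> U.
  move/(prod_topP _ (@open_topology _) (@open_topology _)) => loc.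
  rewrite openE => z /loc[A [B [oA oB Az Bz AB]]].
  by exists (A, B) => //; split; apply: open_nbhs_nbhs.
move=> oU; apply/(prod_topP _ (@open_topology _) (@open_topology _)) => z.
move: oU; rewrite openE => oU /oU [[A B] [/= nA nB] AB].
exists (interior A), (interior B); split; [exact: open_interior..| exact: nA | exact: nB |].
by move=> y [/interior_subset ? /interior_subset ?]; exact: AB.
Qed.

(** The first factor of [G3] is discrete, so openness, closedness and compactness in [G3] can be
    read off from the slices over its points. *)
Definition slice H w : set (R2 * R2) := [set y | H (w, y.1, y.2)].
Definition fiber w A : set (G3 R) := [set g | g.1.1 = w /\ A (g.1.2, g.2)].

Lemma fiberE w A y : fiber w A (w, y.1, y.2) <-> A y.
Proof. by rewrite /fiber/= -surjective_pairing; split=> [[]|]. Qed.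

Lemma slice_fiber w A : slice (fiber w A) w = A.
Proof. by apply/seteqP; split=> y; [move/(fiberE w) | move=> ?; apply/(fiberE w)]. Qed.

Lemma disc_topology (T : Type) : topology_on (@disc_top T).
Proof. by []. Qed.

Lemma tauGP U : tauG U <-> forall w, open (slice U w).
Proof.
split=> [hU w|hU].
  rewrite -tauCkTE; apply/(prod_topP _ (@open_topology _) (@open_topology _)) => y Uy.
  have /(prod_topP _ (gen_top_topology _) (@open_topology _)) := hU.
  move=> /(_ _ Uy)[A [B [tA tB /= Ay By AB]]].
  have /(prod_topP _ (@disc_topology _) (@open_topology _)) := tA.
  move=> /(_ _ Ay)[C [D [_ tD /= Cy Dy CD]]].
  exists D, B; split=> // z [/= Dz Bz]; apply: AB; split=> //; exact: CD.
apply/(prod_topP _ (gen_top_topology _) (@open_topology _)) => -[[w a] b] Ug.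
have := hU w; rewrite -tauCkTE.
move=> /(prod_topP _ (@open_topology _) (@open_topology _)) /(_ (a, b) Ug).
move=> [A [B [tA tB /= Aa Bb AB]]]; exists ([set w] `*` A), B; split=> //.
  by apply: sub_gen_top; exists [set w], A.
by move=> [[w' a'] b'] [[/= -> ?] ?]; exact: (AB (a', b')).
Qed.

Lemma tauG_fiber w A : open A -> tauG (fiber w A).
Proof.
move=> oA; apply/tauGP => v; case: (pselect (v = w)) => [->|vw].
  by rewrite slice_fiber.
rewrite (_ : slice _ _ = set0); first exact: open0.
by apply/seteqP; split=> y // [].
Qed.

Section pk.
Variables p k : nat.

Lemma compact_in_CkT K : compact_in (CkT k) (@tauCkT R) K <-> K `<=` CkT k /\ compact K.
Proof. by rewrite /compact_in tauCkTE; split=> -[h H]; split=> //; exact/(@compact_finite_subcover (R2 * R2)%type point). Qed.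

Lemma compact_in_fiber w K : Cpinf p w -> K `<=` CkT k -> compact K ->
  compact_in (Gpk p k) (@tauG R) (fiber w K).
Proof.
move=> pw Kk /(@compact_finite_subcover (R2 * R2)%type point) cK; split=> [[[w' a] b] [/= -> /Kk []]//|I F tF KF].
have [i|y Ky|J [fJ KJ]] := cK I (fun i => slice (F i) w).
- by have /tauGP := tF i; apply.
- by have [|i _ Fy] := KF (w, y.1, y.2); [exact/fiberE | exists i].
exists J; split=> // -[[w' a] b] [/= -> /KJ[i Ji Fi]]; by exists i.
Qed.

Lemma compact_slice w H : compact_in (Gpk p k) (@tauG R) H -> compact (slice H w).
Proof.
move=> [_ cH]; apply/(@compact_finite_subcover (R2 * R2)%type point) => I F oF HF.
(* A cover of the slice lifts to the fibres over [w]; the index [None] carries the open set of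
   points off that fibre, so that all of [H] is covered. *)
have [[i|]|[[w' a] b] Hg|J [fJ HJ]] :=
  cH (option I) (fun o => if o is Some i then fiber w (F i) else [set g | g.1.1 <> w]).
- exact: tauG_fiber.
- apply/tauGP => v; case: (pselect (v = w)) => vw.
    rewrite (_ : slice _ _ = set0); first exact: open0.
    by apply/seteqP; split=> y.
  by rewrite (_ : slice _ _ = setT); [exact: openT | apply/seteqP; split=> y].
- case: (pselect (w' = w)) => ww; last by exists None.
  have [|i _ Fi] := HF (a, b); first by rewrite /slice/= -ww.
  by exists (Some i).
exists (Some @^-1` J); split.
  by apply: finite_preimage => // i j _ _ [].
by move=> y /HJ[[i|] Ji /= h]; [exists i => //; apply/(fiberE w) | case: h].
Qed.

(** The full fibres over single points are open and cover [H]; finitely many of them suffice. *)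
Lemma compact_in_support H : compact_in (Gpk p k) (@tauG R) H ->
  exists2 D : set R2, finite_set D & forall g, H g -> D g.1.1.
Proof.
move=> [_ cH]; have [w|g Hg|J [fJ HJ]] := cH R2 (fun w => fiber w setT).
- by apply: tauG_fiber; exact: openT.
- by exists g.1.1.
by exists J => // g /HJ[w Jw [-> _]].
Qed.

(** * Continuity of the operations and compactness of [C_k x T] *)

Lemma continuous_cmul (T : topologicalType) (f g : T -> R2) :
  continuous f -> continuous g -> continuous (fun x => cmul (f x) (g x)).
Proof.
move=> cf cg x.
have f1 : (f y).1 @[y --> x] --> (f x).1 by apply: cvg_comp (cf x) _; exact: cvg_fst.
have f2 : (f y).2 @[y --> x] --> (f x).2 by apply: cvg_comp (cf x) _; exact: cvg_snd.
have g1 : (g y).1 @[y --> x] --> (g x).1 by apply: cvg_comp (cg x) _; exact: cvg_fst.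
have g2 : (g y).2 @[y --> x] --> (g x).2 by apply: cvg_comp (cg x) _; exact: cvg_snd.
apply: (@continuous_pair _ _ _ (fun y => (f y).1 * (g y).1 - (f y).2 * (g y).2)
                              (fun y => (f y).1 * (g y).2 + (f y).2 * (g y).1)).
  by apply: cvgB; apply: cvgM.
by apply: cvgD; apply: cvgM.
Qed.

Lemma continuous_cpow n : continuous (fun z : R2 => cpow z n).
Proof.
elim: n => [|n IH]; first exact: cst_continuous.
by apply: continuous_cmul => // x; exact: cvg_id.
Qed.

Lemma continuous_hmul y : continuous (fun x : R2 * R2 => hmul x y).
Proof.
move=> x; apply: (@continuous_pair _ _ _ (fun x : R2 * R2 => cmul x.1 y.1)
                                      (fun x : R2 * R2 => cmul x.2 y.2)); apply: continuous_cmul => z;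
  [exact: cvg_fst | exact: cvg_cst | exact: cvg_snd | exact: cvg_cst].
Qed.

Lemma closed_Tc : closed (@Tc R).
Proof.
have c : continuous (fun z : R2 => z.1 ^+ 2 + z.2 ^+ 2).
  by move=> z; apply: cvgD; apply: cvgM; (exact: cvg_fst || exact: cvg_snd).
exact: ((continuous_closedP _).1 c _ (@closed_eq _ 1)).
Qed.

Lemma closed_rootsU m : closed (@rootsU R m).
Proof.
apply: closedI closed_Tc _.
apply: ((continuous_closedP _).1 (@continuous_cpow m) [set cone R]).
exact/accessible_closed_set1/hausdorff_accessible/norm_hausdorff.
Qed.

Lemma compact_Tc : compact (@Tc R).
Proof.
apply: (@subclosed_compact _ _ (`[(-1 : R), 1]%classic `*` `[(-1 : R), 1]%classic)); first exact: closed_Tc.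
  by apply: compact_setX; exact: segment_compact.
move=> [a b]; rewrite /Tc/= => h; split; rewrite /= in_itv/= -ler_norml -[X in _ <= X]ger0_norm//;
  rewrite -ler_sqr ?nnegrE// real_normK ?num_real// normr1 expr1n -h.
  by rewrite lerDl sqr_ge0.
by rewrite lerDr sqr_ge0.
Qed.

Lemma compact_CkT : compact (@CkT R k).
Proof.
apply: compact_setX compact_Tc; apply: subclosed_compact compact_Tc _; first exact: closed_rootsU.
by move=> z [].
Qed.

Lemma closed_CkT : closed (@CkT R k).
Proof. by apply: compact_closed compact_CkT; exact: norm_hausdorff. Qed.

(** Relative and ambient closedness agree because [C_k x T] is itself closed. *)
Lemma closed_in_CkT A : closed_in (CkT k) (@tauCkT R) A <-> A `<=` CkT k /\ closed A.
Proof.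
rewrite /closed_in /sopen tauCkTE; split=> [[Ak [U [oU E]]]|[Ak cA]]; split=> //.
  rewrite (_ : A = CkT k `&` ~` U).
    by apply: closedI closed_CkT _; exact: open_closedC.
  apply/seteqP; split=> x.
    move=> Ax; split; first exact: Ak.
    move=> Ux; have : (U `&` CkT k) x by split=> //; exact: Ak.
    by rewrite -E => -[].
  move=> [kx nU]; apply: contrapT => nA; apply: nU.
  by have : (CkT k `\` A) x by []; rewrite E => -[].
exists (~` A); split; first exact: closed_openC.
by rewrite setDE setIC.
Qed.

Lemma closed_in_Gpk H :
  closed_in (Gpk p k) (@tauG R) H <-> H `<=` Gpk p k /\ forall w, closed (slice H w).
Proof.
split=> [[Hk [U [/tauGP oU E]]]|[Hk cH]]; split=> //.
  move=> w; case: (pselect (Cpinf p w)) => pw; last first.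
    rewrite (_ : slice H w = set0); first exact: closed0.
    by apply/seteqP; split=> // y /Hk [[]].
  rewrite (_ : slice H w = CkT k `&` ~` slice U w).
    by apply: closedI closed_CkT _; exact: open_closedC.
  apply/seteqP; split=> x.
    move=> Hx; have [[_ ?] ?] := Hk _ Hx; split=> // Ux.
    have : (U `&` Gpk p k) (w, x.1, x.2) by split=> //; exact: Hk.
    by rewrite -E => -[].
  move=> [[k1 k2] nU]; apply: contrapT => nH; apply: nU.
  have : (Gpk p k `\` H) (w, x.1, x.2) by [].
  by rewrite E => -[].
exists (~` H); split; last by rewrite setDE setIC.
by apply/tauGP => w; exact/closed_openC/cH.
Qed.
End pk.

Lemma closed_finite A : finite_set A -> closed A.
Proof.
move: A; apply/accessible_finite_set_closed/hausdorff_accessible; exact: norm_hausdorff.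
Qed.
End Transfer.

(** * The circle *)

Section CircleGroup.
Variable R : realType.
Local Notation R2 := (R2_ R).
Implicit Types (z w : R2) (x y : R2 * R2) (A F : set (R2 * R2)) (k : nat).

Lemma hmulC x y : hmul x y = hmul y x.
Proof. by rewrite /hmul cmulC [cmul x.2 _]cmulC. Qed.

Lemma hmulA x y v : hmul x (hmul y v) = hmul (hmul x y) v.
Proof. by rewrite /hmul/= !cmulA. Qed.

Lemma hmul1 x : hmul (hone R) x = x.
Proof. by rewrite /hmul/= !cmul1 -surjective_pairing. Qed.

Lemma cinvK z : cinv (cinv z) = z.
Proof. by rewrite /cinv/= opprK -surjective_pairing. Qed.

Lemma hinvK x : hinv (hinv x) = x.
Proof. by rewrite /hinv/= !cinvK -surjective_pairing. Qed.

Lemma hmulV k x : CkT k x -> hmul x (hinv x) = hone R.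
Proof. by move=> [[h1 _] h2]; rewrite /hmul/= !cmulV. Qed.

Lemma CkTM k x y : CkT k x -> CkT k y -> CkT k (hmul x y).
Proof. by move=> [h1 h2] [h3 h4]; split; [exact: rootsUM | exact: TcM]. Qed.

Lemma CkTV k x : CkT k x -> CkT k (hinv x).
Proof. by move=> [h1 h2]; split; [exact: rootsUV | exact: TcV]. Qed.

Lemma CkT1 k : CkT k (hone R).
Proof. by split; [exact: rootsU1 | exact: Tc1]. Qed.

Section Subgroup.
Variables (k : nat) (F : set (R2 * R2)).
Hypothesis sF : is_subgroup (@hmul R) (@hinv R) (hone R) (CkT k) F.

Lemma subgroup_inv x : F x -> F (hinv x).
Proof. by case: sF => _ F1 FM Fx; rewrite -[hinv x]hmul1; exact: FM. Qed.

Lemma subgroup_mul x y : F x -> F y -> F (hmul x y).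
Proof. by case: sF => _ _ FM Fx Fy; rewrite -[y]hinvK; apply: FM => //; exact: subgroup_inv. Qed.

Lemma subgroup_pow x n : F x -> F (cpow x.1 n, cpow x.2 n).
Proof.
by move=> Fx; elim: n => [|n IH]; [case: sF | exact: (subgroup_mul Fx IH)].
Qed.

End Subgroup.

(** * Angles, and density of multiples of a small angle *)

Definition expi (t : R) : R2 := (cos t, sin t).

Lemma expiD s t : expi (s + t) = cmul (expi s) (expi t).
Proof. by rewrite /expi cosD sinD /cmul/= [sin s * cos t + _]addrC. Qed.

Lemma Tc_expi t : Tc (expi t).
Proof. exact: cos2Dsin2. Qed.

Lemma expi_mulrn t n : expi (t *+ n) = cpow (expi t) n.
Proof.
elim: n => [|n IH]; first by rewrite mulr0n /expi cos0 sin0.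
by rewrite mulrS expiD IH.
Qed.

Lemma expi2pi t : expi (t + pi *+ 2) = expi t.
Proof. by rewrite /expi cosD2pi sinD2pi. Qed.

(** On the upper half circle [acos] gives the angle, on the lower one [2 pi - acos]. The bound on
    the angle serves the pigeonhole argument for infinite subgroups. *)
Lemma expi_surj z : Tc z -> exists t, [/\ 0 <= t, t <= pi *+ 4 & expi t = z].
Proof.
case: z => a b; rewrite /Tc/= => h.
have a1 : -1 <= a <= 1.
  by rewrite -ler_norml -ler_sqr ?nnegrE// real_normK ?num_real// expr1n -h lerDl sqr_ge0.
have ca : cos (acos a) = a by apply: acosK; rewrite in_itv.
have sa : sin (acos a) = `|b|.
  by rewrite sin_acos// -sqrtr_sqr; congr Num.sqrt; rewrite -h; ring.
have := acos_ge0 a1; have := acos_lepi a1; have := pi_gt0 R.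
case: (leP 0 b) => b0 p0 p1 p2.
  exists (acos a); split=> //; first lra.
  by rewrite /expi ca sa ger0_norm.
exists (- acos a + pi *+ 2); split; [lra | lra |].
by rewrite expi2pi /expi cosN sinN ca sa ltr0_norm// opprK.
Qed.

Lemma continuous_expi : continuous expi.
Proof. by move=> t; apply: continuous_pair; [exact: continuous_cos | exact: continuous_sin]. Qed.

(** The largest multiple of [th] not exceeding [phi] is within [th] of [phi], so it suffices that
    [th] be below the radius given by continuity of [expi]. *)
Lemma expi_multiples_dense (phi : R) (B : set R2) : 0 <= phi -> nbhs (expi phi) B ->
  exists2 d : R, 0 < d & forall th : R, 0 < th < d -> exists n, B (expi (th *+ n)).
Proof.
move=> phi0 /(continuous_expi (x := phi)) /nbhs_ballP[d /= d0 hd].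
exists d => // th /andP[th0 thd]; exists (Num.truncn (phi / th)).
apply: hd; rewrite /ball/=.
have q0 : 0 <= phi / th by rewrite divr_ge0// ltW.
have /andP[h1 h2] := truncn_itv q0.
rewrite ler_pdivlMr// in h1; rewrite ltr_pdivrMr// in h2.
rewrite -mulr_natl ger0_norm ?subr_ge0//.
move: h2; rewrite -natr1 mulrDl mul1r; lra.
Qed.

(** By pigeonhole, two elements of [D] have angles closer than any given [d]. Their quotient has an
    angle in [(0, d)], its powers come near every point of the circle, and [D] is closed. *)
Lemma infinite_closed_subgroup_circle (D : set R2) : closed D -> D `<=` @Tc R ->
  D (cone R) -> (forall z w, D z -> D w -> D (cmul z (cinv w))) ->
  infinite_set D -> D = @Tc R.
Proof.
move=> cD DT D1 DM infD; apply/seteqP; split=> // z Tz.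
have [phi [phi0 _ <-]] := expi_surj Tz.
rewrite ((closure_id _).1 cD) => B /(expi_multiples_dense phi0)[d d0 hd].
have DV w : D w -> D (cinv w) by move=> hw; rewrite -[cinv w]cmul1; exact: DM.
have DX w n : D w -> D (cpow w n).
  move=> hw; elim: n => [//|n IH].
  by rewrite cpowE -[cpow w n]cinvK; apply: DM => //; exact: DV.
suff [th [thd Dth]] : exists th, 0 < th < d /\ D (expi th).
  have [n Bn] := hd _ thd; exists (expi (th *+ n)); split=> //.
  by rewrite expi_mulrn; exact: DX.
apply: contrapT => noth; apply: infD.
pose arg w := xget 0 [set t | [/\ 0 <= t, t <= pi *+ 4 & expi t = w]].
have argP w : D w -> [/\ 0 <= arg w, arg w <= pi *+ 4 & expi (arg w) = w].
  move=> /DT/expi_surj h; exact: (xgetPex 0 h).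
pose b w := Num.truncn (arg w / d).
pose N := (Num.truncn (pi *+ 4 / d)).+1.
(* The angles fall into [N] boxes of length [d]. Without small angles in [D] each box holds at most
   one element, so one chosen representative per box exhausts [D]. *)
apply: (@sub_finite_set _ _ [set xget (cone R) [set w | D w /\ b w = i] | i in `I_N]);
  last by apply: finite_image; exact: finite_II.
move=> w Dw; exists (b w).
  rewrite /= ltnS; apply: le_truncn; rewrite ler_pM2r ?invr_gt0//.
  by have [] := argP _ Dw.
have [Dv bv] := xgetPex (cone R) (ex_intro (fun w' => D w' /\ b w' = b w) w (conj Dw erefl)).
set v := xget _ _ in Dv bv *.
have [v0 v4 ve] := argP _ Dv; have [w0 w4 we] := argP _ Dw.
have close : `|arg v - arg w| < d.
  have qv : 0 <= arg v / d by rewrite divr_ge0// ltW.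
  have qw : 0 <= arg w / d by rewrite divr_ge0// ltW.
  have /andP[] := truncn_itv qv; have /andP[] := truncn_itv qw.
  rewrite -/(b v) -/(b w) bv !ler_pdivlMr// !ltr_pdivrMr// -natr1 mulrDl mul1r => *.
  by rewrite ltr_norml; apply/andP; split; lra.
have sub s t : D (expi s) -> D (expi t) -> D (expi (s - t)).
  by move=> hs ht; rewrite expiD (_ : expi (- t) = cinv (expi t)) ?/expi ?cosN ?sinN//; exact: DM.
apply: contrapT => vw; apply: noth; exists `|arg v - arg w|; split.
  rewrite close andbT normr_gt0 subr_eq0; apply/eqP => E; apply: vw.
  by rewrite -ve -we E.
case: (leP 0 (arg v - arg w)) => h.
  by rewrite ger0_norm//; apply: sub; rewrite ?ve ?we.
by rewrite ltr0_norm// opprB; apply: sub; rewrite ?ve ?we.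
Qed.

(** The multiples of [2 pi / n] are angles of [n]-th roots of unity, and for large [n] this step is
    as small as required. *)
Lemma roots_of_unity_dense z (B : set R2) : Tc z -> nbhs z B ->
  exists n, (0 < n)%N /\ exists2 v, rootsU n v & B v.
Proof.
move=> Tz; have [phi [phi0 _ <-]] := expi_surj Tz.
move=> /(expi_multiples_dense phi0)[d d0 hd].
pose n := (Num.truncn (pi *+ 2 / d)).+1.
have n0 : (0 : R) < n%:R by rewrite ltr0n.
have pi20 : 0 < pi *+ 2 :> R by rewrite pmulrn_lgt0 ?pi_gt0.
have hth : (0 : R) < pi *+ 2 / n%:R < d.
  rewrite divr_gt0//= ltr_pdivrMr// mulrC -ltr_pdivrMr//.
  exact: truncnS_gt.
have [m Bm] := hd _ hth; exists n; split=> //; exists (expi ((pi : R) *+ 2 / n%:R *+ m)) => //.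
split; first exact: Tc_expi.
rewrite -expi_mulrn -mulrnA mulnC mulrnA -[_ *+ n]mulr_natr divfK ?gt_eqF//.
elim: m {Bm} => [|m IH]; first by rewrite mulr0n /expi cos0 sin0.
by rewrite mulrSr expi2pi.
Qed.

(** The part [D] of [F] over 1 in [C_k] is a closed subgroup of the circle. Every other part is
    empty or a translate of [D], and there are finitely many, so [D] is infinite and hence the whole
    circle. *)
Lemma infinite_subgroup_CkT k F : (0 < k)%N ->
  is_subgroup (@hmul R) (@hinv R) (hone R) (CkT k) F -> closed F -> infinite_set F ->
  forall t, Tc t -> F (cone R, t).
Proof.
move=> k0 sF cF infF t Tt; case: (sF) => FT F1 FM.
pose D : set R2 := [set s | F (cone R, s)].
suff DE : D = @Tc R by have : D t by rewrite DE.
apply: infinite_closed_subgroup_circle => //.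
- apply: ((continuous_closedP (fun s : R2 => (cone R, s))).1 _ F cF) => s.
  by apply: continuous_pair; [exact: cvg_cst | exact: cvg_id].
- by move=> s /FT [].
- by move=> z w Dz Dw; have := FM _ _ Dz Dw; rewrite /hmul/= cmulV//; exact: Tc1.
move=> finD; apply: infF.
pose Fc c := [set x | F x /\ x.1 = c].
apply: (@sub_finite_set _ _ (\bigcup_(c in rootsU k) Fc c)).
  by move=> x Fx; exists x.1 => //; case: (FT _ Fx).
apply: bigcup_finite; first exact: rootsU_finite.
move=> c _; case: (pselect (exists x, Fc c x)) => [[x [Fx <-]]|no]; last first.
  by rewrite (_ : Fc c = set0)//; apply/seteqP; split=> // y hy; apply: no; exists y.
apply: (@sub_finite_set _ _ ((fun s => (x.1, cmul x.2 s)) @` D)); last exact: finite_image.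
move=> y [Fy yx]; have [[Tx1 _] Tx2] := FT _ Fx.
exists (cmul (cinv x.2) y.2).
  have := FM _ _ Fy Fx; rewrite /D/= /hmul/= yx cmulV//= => h.
  by rewrite cmulC.
by rewrite /= cmulA cmulV// cmul1 -yx -surjective_pairing.
Qed.

(* Doubling: [1 - Re (u ^ 2) = 2 (1 - Re u) (1 + Re u) >= 2 (1 - Re u)] when [Re u > 0]. *)
Lemma circle_no_small_subgroups t : Tc t -> (forall n, 0 < (cpow t n).1) -> t = cone R.
Proof.
move=> Tt pos.
have Re_le1 (u : R2) : Tc u -> u.1 <= 1.
  move=> Tu; rewrite -[1]ger0_norm//; apply: le_trans (ler_norm _) _.
  by rewrite -ler_sqr ?nnegrE// !real_normK ?num_real// expr1n -Tu lerDl sqr_ge0.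
have grow j : 2 ^+ j * (1 - t.1) <= 1 - (cpow t (2 ^ j)).1.
  elim: j => [|j IH]; first by rewrite expn0 expr0 mul1r cpowE cmulr1.
  rewrite expnSr cpowM; set u := cpow t (2 ^ j) in IH *.
  have Tu : Tc u by exact: TcX.
  have u0 : 0 < u.1 by exact: pos.
  have u1 := Re_le1 _ Tu.
  rewrite !cpowE cmulr1 /= exprS -mulrA.
  have -> : u.2 * u.2 = 1 - u.1 * u.1 by move: Tu; rewrite /Tc/= !expr2 => <-; ring.
  by apply: le_trans (_ : 2 * (1 - u.1) <= _); [rewrite ler_pM2l | nra].
have t1 : t.1 = 1.
  apply/eqP; rewrite eq_le Re_le1//= leNgt; apply/negP => lt1.
  have d0 : 0 < 1 - t.1 by rewrite subr_gt0.
  (* With this [j], [2^(j+1) >= j+1 > 1 / (1 - Re t)], against the bound 1 obtained from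
     doubling. *)
  pose j := Num.truncn (1 - t.1)^-1.
  have := grow j.+1; have := pos (2 ^ j.+1)%N => h1 h2.
  have : 2 ^+ j.+1 * (1 - t.1) < 1 by lra.
  rewrite -ltr_pdivlMr// mul1r => h3.
  have := truncnS_gt (1 - t.1)^-1; rewrite -/j => h4.
  have : (j.+1%:R : R) <= 2 ^+ j.+1 by rewrite -natrX ler_nat ltnW// ltn_expl.
  by lra.
move: Tt; rewrite /Tc/= t1 expr1n => /eqP; rewrite addrC -subr_eq0 addrK sqrf_eq0 => /eqP t2.
by rewrite [t]surjective_pairing t1 t2.
Qed.
End CircleGroup.

(** * Isolation of finite subgroups *)

Section Isolation.
Variable R : realType.
Local Notation R2 := (R2_ R).
Implicit Types (z w : R2) (x y : R2 * R2) (A F : set (R2 * R2)) (k : nat).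

(** Two powers of an element of a finite subgroup coincide, so every element is torsion; the
    exponents are multiplied along an enumeration of [F]. *)
Lemma finite_subgroup_exponent k F :
  is_subgroup (@hmul R) (@hinv R) (hone R) (CkT k) F -> finite_set F ->
  exists2 N, (0 < N)%N & forall x, F x -> cpow x.2 N = cone R.
Proof.
move=> sF finF; case: (sF) => FT _ _.
have torsion x : F x -> exists2 n, (0 < n)%N & cpow x.2 n = cone R.
  move=> Fx; have [_ Tx] := FT _ Fx.
  pose f n := (cpow x.1 n, cpow x.2 n).
  apply: contrapT => no; apply: infinite_nat.
  rewrite (_ : setT = f @^-1` F); last first.
    by apply/seteqP; split=> // n _; exact: (subgroup_pow sF).
  apply: finite_preimage finF => i j _ _ [_ e].
  apply: contrapT => /eqP; rewrite neq_ltn.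
  wlog ij : i j e / (i < j)%N => [H /orP[ij|ij]|_].
  - by apply: (H i j) => //; rewrite ij.
  - by apply: (H j i) => //; rewrite ij.
  apply: no; exists (j - i)%N; first by rewrite subn_gt0.
  have := cmulV (TcX i Tx); rewrite {1}e => <-.
  rewrite -[in RHS](subnK (ltnW ij)).
  have -> : cpow x.2 (j - i + i) = cmul (cpow x.2 (j - i)) (cpow x.2 i).
    by apply: toC_inj; rewrite toCM !toCX exprD.
  by rewrite -cmulA cmulV ?cmulr1//; exact: TcX.
have [s Fs] := (finite_seqP _).1 finF.
suff H (r : seq (R2 * R2)) : (forall x, x \in r -> F x) ->
    exists2 N, (0 < N)%N & forall x, x \in r -> cpow x.2 N = cone R.
  have [|N N0 hN] := H s; first by move=> x xs; rewrite Fs.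
  by exists N => // x; rewrite Fs; exact: hN.
elim: r => [|y r IH] sF'; first by exists 1%N.
have [N N0 hN] : exists2 N, (0 < N)%N & forall x, x \in r -> cpow x.2 N = cone R.
  by apply: IH => x xr; apply: sF'; rewrite inE xr orbT.
have [n n0 hn] := torsion y (sF' y (mem_head _ _)).
exists (n * N)%N; first by rewrite muln_gt0 n0.
move=> x /=; rewrite inE => /orP[/eqP ->|/hN h]; first by rewrite cpowM hn cpow1n.
by rewrite mulnC cpowM h cpow1n.
Qed.

Lemma chabauty_topology (X : Type) (A : set X) tau : topology_on (chabauty A tau).
Proof. exact: gen_top_topology. Qed.

Lemma chabauty_miss (X : Type) (A : set X) tau K :
  compact_in A tau K -> chabauty A tau [set H | H `&` K = set0].
Proof. by move=> cK; apply: sub_gen_top; left; exists K. Qed.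

Lemma chabauty_hit (X : Type) (A : set X) tau U :
  tau U -> chabauty A tau [set H | H `&` U !=set0].
Proof. by move=> tU; apply: sub_gen_top; right; exists U. Qed.

(* If [F] has exponent [N], a subgroup whose [N]-th powers keep positive real part in the circle
   coordinate is [N]-torsion, hence confined to a fixed finite set [E]. *)
Lemma Cfin_isolated k F : (0 < k)%N -> Cfin k F ->
  exists O, [/\ chabauty (CkT k) (@tauCkT R) O, O F &
    forall A, is_subgroup (@hmul R) (@hinv R) (hone R) (CkT k) A -> O A -> A = F].
Proof.
move=> k0 [[clF sF] finF]; have [FT _ _] := sF.
have [N N0 hN] := finite_subgroup_exponent sF finF.
pose E := [set x | CkT k x /\ cpow x.2 N = cone R].
have finE : finite_set E.
  apply: (@sub_finite_set _ _ (rootsU k `*` rootsU N)); last first.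
    by apply: finite_setX; exact: rootsU_finite.
  by move=> x [[h1 h2] h3].
have FE : F `<=` E by move=> x Fx; split; [exact: FT | exact: hN].
pose K2 := [set x : R2 * R2 | CkT k x /\ (cpow x.2 N).1 <= 0].
have cK2 : compact_in (CkT k) (@tauCkT R) K2.
  apply/compact_in_CkT; split=> [x []//|].
  apply: (subclosed_compact _ (@compact_CkT R k)); last by move=> x [].
  apply: closedI; first exact: closed_CkT.
  apply: ((continuous_closedP (fun x : R2 * R2 => (cpow x.2 N).1)).1 _ _ (@closed_le R 0)) => x.
  apply: (@continuous_comp _ _ _ (fun x : R2 * R2 => cpow x.2 N) fst); last exact: cvg_fst.
  apply: (@continuous_comp _ _ _ snd (fun z => cpow z N)); first exact: cvg_snd.
  exact: continuous_cpow.
have cK3 : compact_in (CkT k) (@tauCkT R) (E `\` F).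
  apply/compact_in_CkT; split=> [x [[]]//|].
  apply: (subclosed_compact _ (@compact_CkT R k)); last by move=> x [[]].
  by apply: closed_finite; apply: finite_setD.
have tI U V : chabauty (CkT k) (@tauCkT R) U -> chabauty (CkT k) (@tauCkT R) V ->
    chabauty (CkT k) (@tauCkT R) (U `&` V).
  by have [_ + _] := @chabauty_topology _ (CkT k) (@tauCkT R); apply.
(* Missing [K2] forces a subgroup into [E], and missing [E \ F] then forces it into [F]. Once inside
   [E], hitting the complement of [E] minus [x] means containing [x]. *)
exists ([set A | A `&` K2 = set0] `&` [set A | A `&` (E `\` F) = set0] `&`
        \bigcap_(x in F) [set A | A `&` ~` (E `\ x) !=set0]).
split.
- apply: (tI); first by apply: (tI); exact: chabauty_miss.
  apply: topology_finite_bigcap (chabauty_topology _ _) finF _ => x Fx.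
  apply: chabauty_hit; rewrite tauCkTE; apply: closed_openC.
  by apply: closed_finite; apply: finite_setD.
- split; first split.
  + apply/seteqP; split=> // x [/hN hx [_ /=]].
    by rewrite hx /= ler10.
  + by apply/seteqP; split=> // x [Fx []].
  + by move=> x Fx; exists x; split=> // -[_ /=]; apply.
move=> A sA [[mK2 mK3] hit]; have [AT A1 _] := sA.
have AE : A `<=` E.
  move=> x Ax; split; first exact: AT.
  have [_ Tx] := AT _ Ax.
  apply: circle_no_small_subgroups; first exact: TcX.
  move=> n; rewrite -cpowM mulnC cpowM ltNge; apply/negP => le0.
  suff : (A `&` K2) (cpow x.1 n, cpow x.2 n) by rewrite mK2.
  by split; [|split=> //; apply: AT]; exact: (subgroup_pow sA).
apply/seteqP; split=> x.
  move=> Ax; apply: contrapT => nF; have : (A `&` (E `\` F)) x by split=> //; split=> //; exact: AE.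
  by rewrite mK3.
move=> Fx; have [y [Ay nEy]] := hit _ Fx.
suff -> : x = y by [].
by apply: contrapT => xy; apply: nEy; split; [exact: AE | move=> /= yx; exact: xy].
Qed.

(** Slicing pulls subbasic sets back to subbasic sets: the fibre of a compact set is compact and the
    fibre of an open set is open. *)
Lemma chabauty_slice p k w O : Cpinf p w -> chabauty (CkT k) (@tauCkT R) O ->
  chabauty (Gpk p k) (@tauG R) [set H | O (slice H w)].
Proof.
move=> pw hO.
have [TT TI TU] := @chabauty_topology _ (Gpk p k) (@tauG R).
apply: (hO (fun O => chabauty (Gpk p k) (@tauG R) [set H | O (slice H w)])).
  split=> [//|U V hU hV|I F hF]; first exact: TI.
  rewrite (_ : [set H | _] = \bigcup_(i in setT) [set H | F i (slice H w)]); first exact: TU.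
  by apply/seteqP; split=> H [i _ h]; exists i.
move=> _ [[K [/compact_in_CkT[KT cK] ->]]|[U [tU ->]]].
  rewrite (_ : [set H | _] = [set H | H `&` fiber w K = set0]).
    by apply: chabauty_miss; exact: compact_in_fiber.
  apply/seteqP; split=> H /= h; apply/seteqP; split=> //.
    move=> [[v a] b] [Hg [/= vw Kab]]; subst v.
    by have : (slice H w `&` K) (a, b) by []; rewrite h.
  move=> y [Hy Ky]; have : (H `&` fiber w K) (w, y.1, y.2) by split=> //; exact/fiberE.
  by rewrite h.
rewrite (_ : [set H | _] = [set H | H `&` fiber w U !=set0]).
  by apply: chabauty_hit; apply: tauG_fiber; rewrite -tauCkTE.
apply/seteqP; split=> H /=.
  by move=> [y [Hy Uy]]; exists (w, y.1, y.2); split=> //; exact/fiberE.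
by move=> [[[v a] b] [Hg [/= vw Uab]]]; subst v; exists (a, b).
Qed.

End Isolation.

(** * The quotient by a finite subgroup *)

Section Quotient.
Variable R : realType.
Local Notation R2 := (R2_ R).
Implicit Types (x y : R2 * R2) (t : R2).
Variables (k : nat) (F : set (R2 * R2)).
Hypothesis sF : is_subgroup (@hmul R) (@hinv R) (hone R) (CkT k) F.

Lemma hmulKV x y : CkT k x -> hmul x (hmul (hinv x) y) = y.
Proof. by move=> kx; rewrite hmulA (hmulV kx) hmul1. Qed.

Lemma hmulVK x y : CkT k x -> hmul (hinv x) (hmul x y) = y.
Proof. by move=> kx; rewrite hmulA [hmul _ x]hmulC (hmulV kx) hmul1. Qed.

Lemma cosetP x y : CkT k x -> coset (@hmul R) F x y <-> F (hmul (hinv x) y).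
Proof.
move=> kx; split=> [[h Fh <-]|Fh]; first by rewrite hmulVK.
by exists (hmul (hinv x) y) => //; exact: hmulKV.
Qed.

Lemma coset_self x : coset (@hmul R) F x x.
Proof. by exists (hone R); [case: sF | rewrite hmulC hmul1]. Qed.

Lemma coset_eq x y : CkT k x ->
  coset (@hmul R) F x = coset (@hmul R) F y <-> coset (@hmul R) F x y.
Proof.
move=> kx; split=> [->|]; first exact: coset_self.
move=> [h Fh <-]; apply/seteqP; split=> _ [g Fg <-].
  exists (hmul (hinv h) g); first by apply: (subgroup_mul sF) => //; exact: (subgroup_inv sF).
  rewrite -hmulA; congr hmul; rewrite hmulKV//.
  by case: sF => FT _ _; exact: FT.
by exists (hmul h g); [exact: (subgroup_mul sF) | rewrite hmulA].
Qed.

Lemma coset_sub x : CkT k x -> coset (@hmul R) F x `<=` CkT k.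
Proof. by move=> kx _ [h Fh <-]; apply: CkTM => //; case: sF => FT _ _; exact: FT. Qed.

Lemma coset1 : coset (@hmul R) F (hone R) = F.
Proof. by apply/seteqP; split=> y; rewrite /coset; [move=> [h Fh <-] | exists y => //]; rewrite hmul1. Qed.

Lemma setmul_coset x y :
  setmul (@hmul R) (coset (@hmul R) F x) (coset (@hmul R) F y) = coset (@hmul R) F (hmul x y).
Proof.
apply/seteqP; split=> [_ [_ [g Fg <-] [_ [h Fh <-] <-]]|_ [h Fh <-]].
  exists (hmul g h); first exact: (subgroup_mul sF).
  by rewrite !hmulA; congr hmul; rewrite -!hmulA; congr hmul; exact: hmulC.
exists x; first exact: coset_self.
by exists (hmul y h); [exists h | rewrite hmulA].
Qed.

Lemma quot_topP O : quot_top k F O <->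
  exists2 U, open U & forall x, CkT k x -> O (coset (@hmul R) F x) <-> U x.
Proof.
have E x : (\bigcup_(Q in O `&` quot k F) Q) x <-> CkT k x /\ O (coset (@hmul R) F x).
  split=> [[Q [OQ [y [ky Qy]]] Qx]|[kx Ox]].
    have kx : CkT k x by apply: (coset_sub ky); rewrite -Qy.
    split=> //; suff <- : Q = coset (@hmul R) F x by [].
    by rewrite Qy; apply/coset_eq => //; rewrite -Qy.
  exists (coset (@hmul R) F x); last exact: coset_self.
  by split=> //; exists x.
rewrite /quot_top/= /sopen tauCkTE; split=> [[U [oU EU]]|[U oU EU]].
  exists U => // x kx; split=> [Ox|Ux].
    by have [] : (U `&` CkT k) x by rewrite -EU; apply/E.
  by have /E[] : (\bigcup_(Q in O `&` quot k F) Q) x by rewrite EU.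
exists U; split=> //; apply/seteqP; split=> x.
  by move=> /E[kx Ox]; split=> //; apply/EU.
by move=> [Ux kx]; apply/E; split=> //; apply/EU.
Qed.

Lemma quot_top_hit (U : set (R2 * R2)) : open U -> quot_top k F [set Q | Q `&` U !=set0].
Proof.
move=> oU; apply/quot_topP.
exists (\bigcup_(h in F) (fun x => hmul x h) @^-1` U).
  apply: bigcup_open => h _; apply: open_comp => // x _; exact: continuous_hmul.
move=> x kx; split=> [[_ [[h Fh <-] Uy]]|[h Fh Uy]]; first by exists h.
by exists (hmul x h); split=> //; exists h.
Qed.

(** Pulled back to [C_k x T], the condition is an intersection of translates of the complement of
    [K] indexed by [F]; it is open since [F] is finite. *)
Lemma quot_top_miss (K : set (R2 * R2)) : finite_set F -> closed K -> quot_top k F [set Q | Q `&` K = set0].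
Proof.
move=> finF cK; apply/quot_topP.
exists (\bigcap_(h in F) (fun x => hmul x h) @^-1` ~` K).
  apply: topology_finite_bigcap (@open_topology _) finF _ => h _.
  apply: open_comp => [x _|]; [exact: continuous_hmul | exact: closed_openC].
move=> x kx; split=> [/= E h Fh Ky|miss].
  suff : (coset (@hmul R) F x `&` K) (hmul x h) by rewrite E.
  by split=> //; exists h.
by apply/seteqP; split=> // _ [[h Fh <-] Ky]; exact: (miss h Fh).
Qed.

(** The continuous image of the real line under [b |-> (1, e^(ib)) F] is connected and joins [F] to
    the given coset. *)
Lemma T0_circle t : Tc t -> T0 k F (coset (@hmul R) F (cone R, t)).
Proof.
move=> Tt; have [a [_ _ <-]] := expi_surj Tt.
have kE b : CkT k (cone R, expi b) by split; [exact: rootsU1 | exact: Tc_expi].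
have op O : quot_top k F O -> open [set b | O (coset (@hmul R) F (cone R, expi b))].
  move=> /quot_topP[U oU EU].
  rewrite (_ : [set b | _] = (fun b => (cone R, expi b)) @^-1` U).
    apply: open_comp => // b _; apply: continuous_pair; [exact: cvg_cst | exact: continuous_expi].
  by apply/seteqP; split=> b /(EU _ (kE b)).
exists ((fun b => coset (@hmul R) F (cone R, expi b)) @` setT); split; last first.
  by split; [exists 0 => //; rewrite /expi cos0 sin0; exact: coset1 | exists a].
split=> [_ [b _ <-]|[U [V [qU [qV [cov [[_ [[b _ <-] Ub]] [[_ [[c _ <-] Vc]] disj]]]]]]]].
  by exists (cone R, expi b).
have cR : connected [set: R] by apply/connected_intervalP.
pose B := [set b | U (coset (@hmul R) F (cone R, expi b))].
have BV : B = ~` [set b | V (coset (@hmul R) F (cone R, expi b))].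
  apply/seteqP; split=> d /=.
    move=> Ud Vd; suff : set0 (coset (@hmul R) F (cone R, expi d)) by [].
    by rewrite -disj; split=> //; split=> //; exists d.
  by move=> nV; have [|//|//] := cov (coset (@hmul R) F (cone R, expi d)); exists d.
have BT : B = setT.
  apply: cR; first by exists b.
    by exists B; [exact: op | rewrite setTI].
  by exists B; [rewrite BV; apply: open_closedC; exact: op | rewrite setTI].
have : B c by rewrite BT.
by rewrite BV; apply.
Qed.

(** * The identification of the circle with the identity component *)

Variable iota : R2 -> set (R2 * R2).
Hypothesis idF : identification k F iota.

Lemma iota_coset t : Tc t -> exists2 x, CkT k x & iota t = coset (@hmul R) F x.
Proof.
move=> Tt; case: idF => [[h _ _ _ _] _].
have [S [[Sq _] [_ St]]] := h _ Tt.
by have [x [kx E]] := Sq _ St; exists x.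
Qed.

Lemma iota_sub t : Tc t -> iota t `<=` CkT k.
Proof. by move=> /iota_coset[x kx ->]; exact: coset_sub. Qed.

Lemma iotaP t y : Tc t -> CkT k y -> iota t y <-> coset (@hmul R) F y = iota t.
Proof.
move=> /iota_coset[x kx ->] ky; split=> [xy|<-]; last exact: coset_self.
by symmetry; apply/coset_eq.
Qed.

Lemma iotaM s t : Tc s -> Tc t -> iota (cmul s t) = setmul (@hmul R) (iota s) (iota t).
Proof. by case: idF => _; apply. Qed.

(** The coset [iota 1] is idempotent, hence trivial. *)
Lemma iota1 : iota (cone R) = F.
Proof.
have [x kx E] := iota_coset (@Tc1 R).
have := iotaM (@Tc1 R) (@Tc1 R); rewrite cmul1 E setmul_coset => /coset_eq.
move=> /(_ kx) /(cosetP _ kx); rewrite hmulVK// => Fx.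
rewrite -[RHS]coset1; symmetry; apply/coset_eq; first exact: CkT1.
by exists x; rewrite ?hmul1.
Qed.

Lemma iota_inj s t : Tc s -> Tc t -> iota s = iota t -> s = t.
Proof. by case: idF => [[_ h _ _ _] _]; exact: h. Qed.

Lemma iota_preimage_open O : quot_top k F O ->
  exists2 U : set R2, open U & forall t, Tc t -> O (iota t) <-> U t.
Proof.
case: idF => [[_ _ _ h _] _] /h[U [oU E]]; exists U => // t Tt; split=> [Ot|Ut].
  by have [] : (@Tc R `&` U) t by rewrite -E.
by have [] : (@Tc R `&` iota @^-1` O) t by rewrite E.
Qed.

(** Openness of [iota] onto the identity component turns a condition on [t] into a hitting condition
    on the coset [iota t], which is the shape of a subbasic Chabauty set. *)
Lemma iota_image_open (U : set R2) : open U ->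
  exists2 W, open W & forall t, Tc t -> U t <-> iota t `&` W !=set0.
Proof.
move=> oU; case: idF => [[hT inj _ _ h] _]; have [V [qV E]] := h _ oU.
move: qV => /quot_topP[W oW EW].
exists W => // t Tt; split=> [Ut|[x [tx Wx]]].
  have [x kx Ex] := iota_coset Tt; exists x; split; first by rewrite Ex; exact: coset_self.
  apply/EW => //; rewrite -Ex.
  by have [] : (T0 k F `&` V) (iota t) by rewrite -E; exists t.
have kx := iota_sub Tt tx.
have : (T0 k F `&` V) (iota t).
  split; first exact: hT.
  by rewrite -((iotaP Tt kx).1 tx); apply/EW.
by rewrite -E => -[s [Ts Us] /(inj _ _ Ts Tt) <-].
Qed.

End Quotient.

(** * Discrete subgroups *)

Section DiscreteSubgroups.
Variable R : realType.
Local Notation R2 := (R2_ R).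
Implicit Types (x y : R2 * R2) (w v t : R2) (F : set (R2 * R2)) (H : set (G3 R)) (f : R2 -> R2).
Variables (p k : nat).
Hypotheses (hp : prime p) (hk : (0 < k)%N).
Local Notation subG := (is_subgroup (@gmul R) (@ginv R) (gone R) (Gpk p k)).

Lemma sliceV H w x : subG H -> slice H w x -> slice H (cinv w) (hinv x).
Proof.
move=> [_ H1 HM] /(HM _ _ H1).
by rewrite /gmul/= !cmul1.
Qed.

Lemma sliceM H w v x y : subG H -> slice H w x -> slice H v y ->
  slice H (cmul w v) (hmul x y).
Proof.
move=> sH Hx /(sliceV sH) Hy; case: (sH) => _ _ /(_ _ _ Hx Hy).
by rewrite /gmul/= !cinvK.
Qed.

Lemma sliceX H w x n : subG H -> slice H w x -> slice H (cpow w n) (cpow x.1 n, cpow x.2 n).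
Proof.
move=> sH Hx; elim: n => [|n IH]; first by case: (sH).
exact: (sliceM sH Hx IH).
Qed.

Lemma slice_CkT H w x : H `<=` Gpk p k -> slice H w x -> Cpinf p w /\ CkT k x.
Proof. by move=> HG /HG [[h1 h2] h3]. Qed.

Lemma slice1_subgroup H : subG H ->
  is_subgroup (@hmul R) (@hinv R) (hone R) (CkT k) (slice H (cone R)).
Proof.
move=> sH; case: (sH) => HG H1 _; split=> // [x /(slice_CkT HG) []//|x y Hx Hy].
by have := sliceM sH Hx (sliceV sH Hy); rewrite cinv1 cmul1.
Qed.

Lemma slice_coset H w x : subG H -> slice H w x ->
  slice H w = coset (@hmul R) (slice H (cone R)) x.
Proof.
move=> sH Hx; have [pw kx] : Cpinf p w /\ CkT k x by apply: slice_CkT Hx; case: sH.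
apply/seteqP; split=> y.
  move=> Hy; apply/(cosetP _ _ kx); have := sliceM sH (sliceV sH Hx) Hy.
  by rewrite [cmul _ w]cmulC (cmulV (Cpinf_Tc pw)).
by move=> [h Hh <-]; have := sliceM sH Hx Hh; rewrite cmulr1.
Qed.

Lemma slice_finite H w : subG H -> finite_set (slice H (cone R)) -> finite_set (slice H w).
Proof.
move=> sH fin; case: (pselect (slice H w !=set0)) => [[x Hx]|/set0P/negP/negbNE/eqP ->//].
by rewrite (slice_coset sH Hx); exact: finite_image.
Qed.

Lemma subset_slices H H' : H `<=` Gpk p k ->
  (forall w, Cpinf p w -> slice H w `<=` slice H' w) -> H `<=` H'.
Proof.
by move=> HG sl [[w a] b] Hg; have [[pw _] _] := HG _ Hg; exact: (sl w pw (a, b)).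
Qed.

Lemma eq_slices H H' : H `<=` Gpk p k -> H' `<=` Gpk p k ->
  (forall w, Cpinf p w -> slice H w = slice H' w) -> H = H'.
Proof.
by move=> HG HG' E; apply/seteqP; split; apply: subset_slices => // w /E ->.
Qed.

Lemma CG_slice1 H : CG p k H ->
  closed_subgroups (@hmul R) (@hinv R) (hone R) (CkT k) (@tauCkT R) (slice H (cone R)).
Proof.
move=> [/closed_in_Gpk[HG cH] sH]; split; last exact: slice1_subgroup.
by apply/closed_in_CkT; split=> // x /(slice_CkT HG) [].
Qed.

(** Nonempty slices over an infinite group make [H] infinite. All slices are finite, so deleting the
    other points of its slice from an open fibre isolates a given point. *)
Lemma Cdis_of_slices H : CG p k H -> (forall w, Cpinf p w -> slice H w !=set0) ->
  finite_set (slice H (cone R)) -> Cdis p k H.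
Proof.
move=> cH surj fin; have [clH sH] := cH; split=> //; split.
  move=> finH; apply: (@Cpinf_infinite R _ hp).
  apply: (@sub_finite_set _ _ [set g.1.1 | g in H]); last exact: finite_image.
  by move=> w /surj[x Hx]; exists (w, x.1, x.2).
move=> [[w a] b] Hg; exists (fiber w (~` (slice H w `\ (a, b)))); split.
  apply: tauG_fiber; apply: closed_openC; apply: closed_finite; apply: finite_setD.
  exact: slice_finite.
apply/seteqP; split=> [[[v a'] b'] [[/= vw nH] Hg']|_ ->].
  subst v; apply: contrapT => ne; apply: nH; split=> // -[/= ea eb].
  by apply: ne; rewrite ea eb.
by split=> //; split=> // -[_ /=]; apply.
Qed.

Lemma Cdis_Cfin H : Cdis p k H -> Cfin k (slice H (cone R)).
Proof.
move=> [cH [_ dis]]; split; first exact: CG_slice1.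
have [clF [FT _ _]] := CG_slice1 cH.
have cF : compact (slice H (cone R)).
  apply: (subclosed_compact _ (@compact_CkT R k) FT).
  by case/closed_in_CkT: clF.
have {}dis x : slice H (cone R) x -> exists2 U, open U & U `&` slice H (cone R) = [set x].
  move=> /dis[U [/tauGP tU E]]; exists (slice U (cone R)) => //.
  apply/seteqP; split=> [y [Uy Hy]|_ ->].
    have : (U `&` H) (cone R, y.1, y.2) by [].
    rewrite E => -[e1 e2].
    by rewrite /= [y]surjective_pairing e1 e2 -surjective_pairing.
  by have [] : (U `&` H) (cone R, x.1, x.2) by rewrite E.
have ex x : exists U : set (R2 * R2), slice H (cone R) x -> open U /\ U `&` slice H (cone R) = [set x].
  case: (pselect (slice H (cone R) x)) => [/dis[U oU E]|nx]; last by exists set0.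
  by exists U.
have [g hg] := choice ex.
have [i|x Hx|J [finJ HJ]] := (@compact_finite_subcover (R2 * R2)%type point (slice H (cone R))).1 cF
    {x | slice H (cone R) x} (fun i => g (sval i)).
- by case: i => x Hx /=; case: (hg x Hx).
- exists (exist _ x Hx) => //=; have [_ E] := hg x Hx.
  by have [] : (g x `&` slice H (cone R)) x by rewrite E.
apply: (@sub_finite_set _ _ (sval @` J)); last exact: finite_image.
move=> x Hx; have [[y Hy] Jy /= gx] := HJ _ Hx; exists (exist _ y Hy) => //=.
have [_ E] := hg y Hy.
by have : (g y `&` slice H (cone R)) x by []; rewrite E.
Qed.

(** The projection of [H] to the Prüfer group is infinite, as otherwise [H] would be a finite union
    of finite slices. *)
Lemma Cdis_surj H w : Cdis p k H -> Cpinf p w -> slice H w !=set0.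
Proof.
move=> dH; have [_ finF] := Cdis_Cfin dH; have [cH [infH _]] := dH.
have [/closed_in_Gpk[HG _] sH] := cH.
pose P := [set v | slice H v !=set0].
suff PE : P = Cpinf p by move=> pw; have : P w by rewrite PE.
apply: infinite_sub_Cpinf => //.
- move=> finP; apply: infH.
  apply: (@sub_finite_set _ _ (\bigcup_(v in P) ((fun x => (v, x.1, x.2)) @` slice H v))).
    by move=> [[v a] b] Hg; exists v; [exists (a, b) | exists (a, b)].
  by apply: bigcup_finite => // v _; apply: finite_image; exact: slice_finite.
- by move=> v [x /(slice_CkT HG) []].
- by exists (hone R); case: (sH).
- by move=> z v [x Hx] [y Hy]; exists (hmul x y); exact: sliceM.
Qed.

Lemma dual1 f : dual p f -> f (cone R) = cone R.
Proof.
move=> [fT [fM _]]; have p1 := @Cpinf1 R p; have := fM _ _ p1 p1; rewrite cmul1 => E.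
by have := cmulV (fT _ p1); rewrite {1}E -cmulA cmulV ?cmulr1//; exact: fT.
Qed.

(** * The subgroups [H_{F,f}] *)

Section Graph.
Variables (iota : set (R2 * R2) -> R2 -> set (R2 * R2)).
Hypothesis hiota : forall F, Cfin k F -> identification k F (iota F).
Local Notation Hf := (Hff p k iota).

Lemma Hff_Gpk F f : Hf F f `<=` Gpk p k.
Proof. by move=> g []. Qed.

Lemma slice_Hff F f w : Cfin k F -> dual p f -> Cpinf p w ->
  slice (Hf F f) w = iota F (f w).
Proof.
move=> cF [fT _] pw; have [[_ sF] _] := cF; have Tf := fT _ pw.
apply/seteqP; split=> y.
  by case: y => a b [[[_ k1] k2] /= E]; apply/(iotaP sF (hiota cF) Tf).
move=> iy; have ky := iota_sub sF (hiota cF) Tf iy.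
split; first by case: ky.
by rewrite /= -surjective_pairing; apply/(iotaP sF (hiota cF) Tf).
Qed.

Lemma Hff_slice1 F f : Cfin k F -> dual p f -> slice (Hf F f) (cone R) = F.
Proof.
move=> cF df; have [[_ sF] _] := cF.
by rewrite slice_Hff// ?dual1//; [exact: (iota1 sF (hiota cF)) | exact: Cpinf1].
Qed.

Lemma Hff_Cdis F f : Cfin k F -> dual p f -> Cdis p k (Hf F f).
Proof.
move=> cF df; have [[clF sF] finF] := cF; have [fT [fM f1]] := df.
have isl w : Cpinf p w -> exists2 x, CkT k x & slice (Hf F f) w = coset (@hmul R) F x.
  by move=> pw; rewrite slice_Hff//; apply: (iota_coset (hiota cF)); exact: fT.
apply: Cdis_of_slices; last by rewrite Hff_slice1.
  split.
    apply/closed_in_Gpk; split; first exact: Hff_Gpk.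
    move=> w; case: (pselect (Cpinf p w)) => [/isl[x _ ->]|npw].
      by apply: closed_finite; exact: finite_image.
    rewrite (_ : slice _ _ = set0); first exact: closed0.
    by apply/seteqP; split=> // y [[[]]].
  split; first exact: Hff_Gpk.
    have := Hff_slice1 cF df; case: sF => _ F1 _ E.
    by have : slice (Hf F f) (cone R) (hone R) by rewrite E.
  move=> [[w a] b] [[v c] d] Hx Hy.
  have [pw kx] : Cpinf p w /\ CkT k (a, b) by apply: slice_CkT Hx; exact: Hff_Gpk.
  have [pv ky] : Cpinf p v /\ CkT k (c, d) by apply: slice_CkT Hy; exact: Hff_Gpk.
  have pq : Cpinf p (cmul w (cinv v)) by apply: CpinfM => //; exact: CpinfV.
  have {}Hx : slice (Hf F f) w (a, b) by [].
  have {}Hy : slice (Hf F f) v (c, d) by [].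
  suff : slice (Hf F f) (cmul w (cinv v)) (hmul (a, b) (hinv (c, d))) by [].
  have Tw := fT _ pw; have Tv := fT _ pv; have Tq := fT _ pq.
  move: Hx Hy; rewrite !slice_Hff// => Hx Hy.
  (* Splitting [w] as [w v^-1] times [v] exhibits the slice over [w] as the product of the slice
     over the quotient with the coset of [(c, d)], which can then be cancelled. *)
  have E : cmul (f (cmul w (cinv v))) (f v) = f w.
    by rewrite -fM// -cmulA [cmul (cinv v) v]cmulC (cmulV (Cpinf_Tc pv)) cmulr1.
  have [x kx' Ex] := iota_coset (hiota cF) Tq.
  have Ey := (iotaP sF (hiota cF) Tv ky).1 Hy.
  move: Hx; rewrite -E (iotaM (hiota cF))// Ex -Ey (setmul_coset sF) => -[h Fh Eh].
  exists h => //; rewrite -Eh -!hmulA; congr hmul.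
  by rewrite [hmul h _]hmulC hmulA (hmulV ky) hmul1.
by move=> w /isl[x _ ->]; exists x; exact: coset_self sF x.
Qed.

Lemma Hff_inj F f F' f' : Cfin k F -> dual p f -> Cfin k F' -> dual p f' ->
  Hf F f = Hf F' f' -> (F, f) = (F', f').
Proof.
move=> cF df cF' df' E.
have EF : F = F' by rewrite -(Hff_slice1 cF df) E Hff_slice1.
subst F'; congr pair; apply/funext => w; have [[_ sF] _] := cF.
have [fT [_ f1]] := df; have [fT' [_ f1']] := df'.
case: (pselect (Cpinf p w)) => pw; last by rewrite f1// f1'.
apply: (iota_inj (hiota cF)); [exact: fT | exact: fT' |].
by rewrite -!slice_Hff// E.
Qed.

Lemma Hff_surj H : Cdis p k H -> exists Ff, (Cfin k `*` dual p) Ff /\ Hf Ff.1 Ff.2 = H.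
Proof.
move=> dH; have cF := Cdis_Cfin dH; set F := slice H (cone R) in cF.
have [cH _] := dH; have [/closed_in_Gpk[HG _] sH] := cH; have [[_ sF] _] := cF.
(* The value 1 off the Prüfer group is the normalisation required by [dual]. *)
have ex w : exists t, if `[<Cpinf p w>] then Tc t /\ slice H w = iota F t else t = cone R.
  case: asboolP => pw; last by exists (cone R).
  (* Taking a [k]-th power kills the [C_k] coordinate, so the slice over [w = v^k] contains some
     [(1, s)] and is a coset in the identity component. *)
  have [v pv vk] := Cpinf_divisible hp hk pw.
  have [x Hx] := Cdis_surj dH pv.
  have := sliceX k sH Hx; rewrite vk => Hxk.
  have [_ [[_ xk] Tx]] := slice_CkT HG Hx.
  rewrite xk in Hxk; rewrite (slice_coset sH Hxk) -/F.
  have [[_ _ onto _ _] _] := hiota cF.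
  by have [t Tt <-] := onto _ (T0_circle sF (TcX k Tx)); exists t.
have [f hf] := choice ex.
have hfp w : Cpinf p w -> Tc (f w) /\ slice H w = iota F (f w).
  by move=> pw; have := hf w; case: asboolP.
have df : dual p f.
  split; first by move=> w /hfp [].
  split; last by move=> w npw; have := hf w; case: asboolP.
  move=> w v pw pv; have [Tw Ew] := hfp w pw; have [Tv Ev] := hfp v pv.
  have [Twv Ewv] := hfp _ (CpinfM pw pv).
  apply: (iota_inj (hiota cF)) => //; first exact: TcM.
  rewrite (iotaM (hiota cF))// -Ew -Ev -Ewv.
  have [x Hx] := Cdis_surj dH pw; have [y Hy] := Cdis_surj dH pv.
  rewrite (slice_coset sH (sliceM sH Hx Hy)) (slice_coset sH Hx) (slice_coset sH Hy).
  by rewrite (setmul_coset sF).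
exists (F, f); split=> //; apply: eq_slices => //; first exact: Hff_Gpk.
by move=> w pw /=; rewrite slice_Hff//; have [_ ->] := hfp w pw.
Qed.

End Graph.
End DiscreteSubgroups.

(** * The homeomorphism and the closure *)

Section Locality.
Variables (X Y Z : Type) (tX : set (set X)) (r : Z -> X) (h : Z -> Y) (A : set Z).
Hypothesis topX : topology_on tX.

(** One notion serves both directions of the homeomorphism: [r = id] with [h = alpha] expresses
    continuity on [A], and [r = alpha] with [h = id] expresses openness onto the image. *)
Definition locally_in (z : Z) (P : set Z) : Prop :=
  exists U, [/\ tX U, U (r z) & forall z', A z' -> U (r z') -> P z'].

Lemma locally_in_gen_top (B : set (set Y)) z :
  (forall V, B V -> V (h z) -> locally_in z (h @^-1` V)) ->
  forall V, gen_top B V -> V (h z) -> locally_in z (h @^-1` V).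
Proof.
move=> hB V hV; case: topX => XT XI _.
apply: (hV (fun V => V (h z) -> locally_in z (h @^-1` V))) => //; split.
- by move=> _; exists setT.
- move=> U1 U2 h1 h2 [/h1[W1 [t1 m1 s1]] /h2[W2 [t2 m2 s2]]].
  exists (W1 `&` W2); split=> //; first exact: XI.
  by move=> z' Az' [w1 w2]; split; [exact: s1 | exact: s2].
- move=> I F hF [i _ /hF[W [t m s]]]; exists W; split=> // z' Az' w.
  by exists i => //; exact: s.
Qed.

Lemma locally_in_open (P : set Z) : (forall z, A z -> P z -> locally_in z P) ->
  exists2 U, tX U & forall z, A z -> P z <-> U (r z).
Proof.
move=> hP; case: topX => _ _ XU.
pose I := {U : set X | tX U /\ forall z, A z -> U (r z) -> P z}.
exists (\bigcup_(i in @setT I) sval i); first by apply: XU => -[U []].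
move=> z Az; split=> [/(hP _ Az)[U [tU Uz UP]]|[[U [tU UP]] _ /= Uz]]; last exact: UP.
by exists (exist _ U (conj tU UP)).
Qed.

End Locality.

Section Main.
Variable R : realType.
Local Notation R2 := (R2_ R).
Implicit Types (x y : R2 * R2) (w v t : R2) (F : set (R2 * R2)) (H : set (G3 R)) (f : R2 -> R2).
Variables (p k : nat).
Hypotheses (hp : prime p) (hk : (0 < k)%N).
Local Notation tauC := (chabauty (CkT k) (@tauCkT R)).
Local Notation tauH := (chabauty (Gpk p k) (@tauG R)).

Lemma compact_in_disc (K : set R2) : compact_in (Cpinf p) (@disc_top R2) K -> finite_set K.
Proof.
move=> [_ cK]; have [//|w Kw|J [finJ KJ]] := cK R2 set1; first by exists w.
by apply: sub_finite_set finJ => w /KJ[v Jv ->].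
Qed.

Lemma dual_top_eval w (U : set R2) : Cpinf p w -> open U -> dual_top p [set f | U (f w)].
Proof.
move=> pw oU; apply: sub_gen_top; exists [set w], U; split; last first.
  split=> //; apply/seteqP; split=> f /=; first by move=> Uf _ ->.
  exact.
split=> [_ ->//|I F _ wF]; have [i _ Fi] := wF w erefl.
by exists [set i]; split=> // _ ->; exists i.
Qed.

Lemma dual_top_topology : topology_on (@dual_top R p).
Proof. exact: gen_top_topology. Qed.

Section Homeomorphism.
Variables (iota : set (R2 * R2) -> R2 -> set (R2 * R2)).
Hypothesis hiota : forall F, Cfin k F -> identification k F (iota F).
Local Notation Hf := (Hff p k iota).
Local Notation alpha := (fun Ff : set (R2 * R2) * (R2 -> R2) => Hf Ff.1 Ff.2).

(** The isolating neighbourhood [NF0] fixes [F]. Missing a compact set then constrains [f] only at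
    the finitely many points of its support, and hitting an open set only at one point. *)
Lemma alpha_continuous V z : (Cfin k `*` dual p) z -> tauH V -> V (alpha z) ->
  locally_in (prod_top tauC (dual_top p)) id (Cfin k `*` dual p) z (alpha @^-1` V).
Proof.
case: z => F f [/= cF df] hV; have [[_ sF] finF] := cF.
have [NF0 [tNF NF0F isoF]] := Cfin_isolated hk cF.
have rect (W : set (R2 -> R2)) : dual_top p W -> prod_top tauC (dual_top p) (NF0 `*` W).
  by move=> tW; apply: sub_gen_top; exists NF0, W.
apply: (@locally_in_gen_top _ _ _ _ id alpha _ (gen_top_topology _) _ (F, f) _ V hV).
move=> _ [[K [cK ->]]|[U [tU ->]]] /=.
  move=> miss; have [D finD KD] := compact_in_support cK.
  have ex w : exists U : set R2, open U /\
      forall t, Tc t -> iota F t `&` slice K w = set0 <-> U t.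
    have qO : quot_top k F [set Q | Q `&` slice K w = set0].
      apply: (quot_top_miss sF) => //; apply: compact_closed; first exact: norm_hausdorff.
      exact: compact_slice cK.
    by have [U oU EU] := iota_preimage_open (hiota cF) qO; exists U.
  have [U hU] := choice ex.
  exists (NF0 `*` \bigcap_(w in D `&` Cpinf p) [set f | U w (f w)]); split.
  - apply: rect; apply: topology_finite_bigcap dual_top_topology _ _; first exact: finite_setIl.
    by move=> w [_ pw]; apply: dual_top_eval => //; case: (hU w).
  - split=> //= w [_ pw]; case: (df) => fT _; apply/((hU w).2 _ (fT _ pw)).
    apply/seteqP; split=> // y [iy Ky].
    suff : (Hf F f `&` K) (w, y.1, y.2) by rewrite miss.
    by split=> //; rewrite -(slice_Hff hiota cF df pw) in iy.
  - move=> [F' f'] [/= cF' df'] [/= /isoF EF hf'].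
    have {EF} EF : F' = F by apply: EF; case: cF' => [[]].
    subst F'; apply/seteqP; split=> // -[[w a] b] [Hg Kg].
    have [[pw _] _] := Hff_Gpk Hg.
    have Uw : U w (f' w) by apply: hf'; split=> //; exact: KD Kg.
    case: (df') => fT _; have E := ((hU w).2 _ (fT _ pw)).2 Uw.
    suff : (iota F (f' w) `&` slice K w) (a, b) by rewrite E.
    by split=> //; rewrite -(slice_Hff hiota cF df' pw).
move=> [[[w a] b] [Hg Ug]]; have [[pw _] _] := Hff_Gpk Hg.
have qO : quot_top k F [set Q | Q `&` slice U w !=set0].
  by apply: (quot_top_hit sF); move/tauGP : tU.
have [W oW EW] := iota_preimage_open (hiota cF) qO.
exists (NF0 `*` [set f | W (f w)]); split.
- by apply: rect; exact: dual_top_eval.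
- split=> //=; apply/EW; first by case: df => fT _; exact: fT.
  exists (a, b); split=> //; by rewrite -(slice_Hff hiota cF df pw).
- move=> [F' f'] [/= cF' df'] [/= /isoF EF Wf'].
  have {EF} EF : F' = F by apply: EF; case: cF' => [[]].
  subst F'; case: (df') => fT _.
  have [y [iy Uy]] := (EW _ (fT _ pw)).2 Wf'.
  exists (w, y.1, y.2); split=> //.
  by rewrite -(slice_Hff hiota cF df' pw) in iy.
Qed.

(** For fixed [F], a subbasic neighbourhood of [f] amounts to hitting open fibres over finitely many
    points; the slice over 1, kept in [NF0], fixes [F]. *)
Lemma alpha_open U z : (Cfin k `*` dual p) z -> prod_top tauC (dual_top p) U -> U z ->
  locally_in tauH alpha (Cfin k `*` dual p) z U.
Proof.
case: z => F f [/= cF df] /(prod_topP _ (chabauty_topology _ _) dual_top_topology) hU.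
move=> /hU[U1 [U2 [_ tU2 /= U1F U2f U12]]]; have [[_ sF] finF] := cF.
have [NF0 [tNF NF0F isoF]] := Cfin_isolated hk cF.
have [_ tI _] := chabauty_topology (Gpk p k) (@tauG R).
have [V [tV Vf VU2]] : locally_in tauH (Hf F) (dual p) f (id @^-1` U2).
  apply: (@locally_in_gen_top _ _ _ _ _ id _ (chabauty_topology _ _) _ f _ U2 tU2 U2f).
  move=> _ [K [W [cK [oW ->]]]] /= KW.
  have Kp : K `<=` Cpinf p by case: cK.
  have [W' oW' EW'] := iota_image_open sF (hiota cF) oW.
  exists (\bigcap_(w in K) [set H | H `&` fiber w W' !=set0]); split.
  - apply: topology_finite_bigcap (chabauty_topology _ _) (compact_in_disc cK) _ => w _.
    by apply: chabauty_hit; exact: tauG_fiber.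
  - move=> w Kw; have pw := Kp _ Kw; case: (df) => fT _.
    have [y [iy Wy]] := (EW' _ (fT _ pw)).1 (KW _ Kw).
    exists (w, y.1, y.2); split; last exact/fiberE.
    by rewrite -(slice_Hff hiota cF df pw) in iy.
  - move=> f' df' hit w Kw; have pw := Kp _ Kw; case: (df') => fT _.
    apply/(EW' _ (fT _ pw)); have [[[v a] b] [Hg [/= vw Wab]]] := hit _ Kw; subst v.
    by exists (a, b); split=> //; rewrite -(slice_Hff hiota cF df' pw).
exists ([set H | NF0 (slice H (cone R))] `&` V); split.
- by apply: (tI) => //; apply: chabauty_slice tNF; exact: Cpinf1.
- by split=> //=; rewrite (Hff_slice1 hiota).
move=> [F' f'] [/= cF' df'] [/=]; rewrite (Hff_slice1 hiota)// => /isoF EF Vf'.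
have {EF} EF : F' = F by apply: EF; case: cF' => [[]].
by subst F'; apply: U12; split=> //=; exact: VU2.
Qed.

Lemma alpha_homeo :
  homeo (Cfin k `*` dual p) (prod_top tauC (dual_top p)) (Cdis p k) tauH alpha.
Proof.
split.
- by move=> [F f] [/= cF df]; exact: Hff_Cdis.
- by move=> [F f] [F' f'] [/= ? ?] [/= ? ?]; exact: Hff_inj.
- by move=> H /(Hff_surj hp hk hiota)[Ff [? ?]]; exists Ff.
- move=> V tV; have [|U tU EU] := @locally_in_open _ _ (prod_top tauC (dual_top p)) id
      (Cfin k `*` dual p) (gen_top_topology _) (alpha @^-1` V).
    by move=> z Az; exact: alpha_continuous.
  by exists U; split=> //; apply/seteqP; split=> z [Az h]; split=> //; apply/(EU z Az).
- move=> U tU; have [|V tV EV] := @locally_in_open _ _ tauH alpha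
      (Cfin k `*` dual p) (chabauty_topology _ _) U.
    by move=> z Az; exact: alpha_open.
  exists V; split=> //; apply/seteqP; split=> [_ [z [Az Uz] <-]|H [dH VH]].
    by split; [case: (Az) => *; exact: Hff_Cdis | apply/(EV z Az)].
  have [z [Az zH]] := Hff_surj hp hk hiota dH.
  by exists z => //; split=> //; apply/(EV z Az); rewrite zH.
Qed.

End Homeomorphism.

(** * The closure of the set of discrete subgroups *)

Lemma slice_prod (B C : set R2) w : Cpinf p w -> slice (Cpinf p `*` B `*` C) w = B `*` C.
Proof. by move=> pw; apply/seteqP; split=> y; [move=> [[]] | move=> []]. Qed.

Lemma prod_CG (B C : set R2) : closed (B `*` C) ->
  is_subgroup (@hmul R) (@hinv R) (hone R) (CkT k) (B `*` C) ->
  CG p k (Cpinf p `*` B `*` C).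
Proof.
move=> cBC [BCk BC1 BCM]; have sub : Cpinf p `*` B `*` C `<=` Gpk p k.
  by move=> [[w a] b] [[/= pw Ba] Cb]; have [] := BCk (a, b) (conj Ba Cb).
split.
  apply/closed_in_Gpk; split=> // w; case: (pselect (Cpinf p w)) => pw; first by rewrite slice_prod.
  rewrite (_ : slice _ _ = set0); first exact: closed0.
  by apply/seteqP; split=> // y [[]].
split=> //; first by case: BC1; split=> //; split=> //; exact: Cpinf1.
move=> [[w a] b] [[v c] d] [[/= pw Ba] Cb] [[/= pv Bc] Cd].
have [? ?] := BCM (a, b) (c, d) (conj Ba Cb) (conj Bc Cd).
by split=> //; split=> //; apply: CpinfM => //; exact: CpinfV.
Qed.

Lemma Cdis_closure : closure_in (CG p k) tauH (Cdis p k) `<=`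
  Cdis p k `|` [set H | exists d : nat, [/\ leq 1 d, dvdn d k &
                                           H = Cpinf p `*` rootsU d `*` @Tc R]].
Proof.
move=> H [cH near]; have [/closed_in_Gpk[HG clH] sH] := cH.
have surj w : Cpinf p w -> slice H w !=set0.
  move=> pw; apply: contrapT => no.
  have cK : compact_in (Gpk p k) (@tauG R) (fiber w (CkT k)).
    by apply: compact_in_fiber => //; exact: compact_CkT.
  have [|H' [dH' miss]] := near _ (chabauty_miss cK).
    apply/seteqP; split=> // -[[v a] b] [Hg [/= vw _]]; subst v.
    by apply: no; exists (a, b).
  have [x Hx] := Cdis_surj hp dH' pw.
  have [/closed_in_Gpk[HG' _] _] := dH'.1.
  have [_ kx] := slice_CkT HG' Hx.
  suff : (H' `&` fiber w (CkT k)) (w, x.1, x.2) by rewrite miss.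
  by split=> //; exact/fiberE.
case: (pselect (finite_set (slice H (cone R)))) => fin; first by left; exact: Cdis_of_slices.
right; have s1 := slice1_subgroup sH; have [F1T F11 F1M] := s1.
have circ t : Tc t -> slice H (cone R) (cone R, t).
  exact: (infinite_subgroup_CkT hk s1 (clH _) fin).
(* The [k]-th power of a point over a [k]-th root of [w] has trivial [C_k] coordinate; its circle
   coordinate is removed using the circle inside [H]. *)
have triv w : Cpinf p w -> slice H w (hone R).
  move=> /(Cpinf_divisible hp hk)[v pv <-]; have [x Hx] := surj _ pv.
  have [_ [[_ xk] Tx]] := slice_CkT HG Hx.
  have := sliceM sH (sliceX k sH Hx) (circ _ (TcV (TcX k Tx))).
  by rewrite xk cmulr1 /hmul/= cmul1 cmulV//; exact: TcX.
(* As [H] contains both the Prüfer group and the circle, it is determined by its trace [B] on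
   [C_k]. *)
pose B := [set c | slice H (cone R) (c, cone R)].
have [d [d1 dk BE]] : exists d, [/\ (1 <= d)%N, (d %| k)%N & B = rootsU d].
  apply: subgroup_rootsU => //; first by move=> c /F1T [].
  move=> c e Bc Be; have := F1M _ _ Bc Be.
  by rewrite /hmul/= cmulV//; exact: Tc1.
exists d; split=> //; rewrite -BE; apply/seteqP; split=> [[[w c] t] Hg|[[w c] t] [[/= pw Bc] Tt]].
  have [[pw kc] Tt] := HG _ Hg; split=> //; split=> //=.
  have := sliceM sH (sliceM sH (Hg : slice H w (c, t)) (sliceV sH (triv _ pw)))
                    (circ _ (TcV Tt)).
  rewrite cmulr1 (cmulV (Cpinf_Tc pw)) /hmul/= cinv1 !cmulr1.
  by rewrite (cmulV Tt).
have := sliceM sH (sliceM sH (triv _ pw) Bc) (circ _ Tt).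
by rewrite !cmulr1 /hmul/= !cmul1 cmulr1.
Qed.

Lemma rootsU_Tc_closure d : (0 < d)%N -> (d %| k)%N ->
  closure_in (CG p k) tauH (Cdis p k) (Cpinf p `*` rootsU d `*` @Tc R).
Proof.
move=> d0 dk.
have sub_dk : rootsU d `<=` @rootsU R k by exact: rootsU_dvd.
split.
  apply: prod_CG; first exact: (@closed_CkT R d).
  split; [by move=> x [/sub_dk] | exact: (@CkT1 R d) |].
  by move=> x y hx hy; apply: (@CkTM R d) => //; exact: CkTV.
set Hd := _ `*` _; pose L n : set (G3 R) := Cpinf p `*` rootsU d `*` rootsU n`!.
have LC n : Cdis p k (L n).
  have fin : finite_set (@rootsU R d `*` @rootsU R n`!).
    by apply: finite_setX; apply: rootsU_finite => //; exact: fact_gt0.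
  apply: Cdis_of_slices => //.
  - apply: prod_CG; first exact: closed_finite.
    split; [by move=> x [/sub_dk ? []] | by split; exact: rootsU1 |].
    by move=> x y [? ?] [? ?]; split; apply: rootsUM => //; exact: rootsUV.
  - by move=> w pw; rewrite slice_prod//; exists (hone R); split; exact: rootsU1.
  - by rewrite slice_prod//; exact: Cpinf1.
(* Holding for all large [n], rather than for some [n], survives finite intersections, which reduces
   the claim to subbasic sets. *)
suff ev U : tauH U -> U Hd -> exists n0, forall n, (n0 <= n)%N -> U (L n).
  by move=> U tU /(ev U tU)[n0 hn0]; exists (L n0); split=> //; exact: hn0.
move=> tU; apply: (tU (fun U => U Hd -> exists n0, forall n, (n0 <= n)%N -> U (L n))).
  split; first by exists 0%N.
  - move=> U1 U2 h1 h2 [/h1[n1 hn1] /h2[n2 hn2]]; exists (maxn n1 n2) => n.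
    by rewrite geq_max => /andP[? ?]; split; [exact: hn1 | exact: hn2].
  - by move=> I F hF [i _ /hF[n0 hn0]]; exists n0 => n nn0; exists i => //; exact: hn0.
move=> _ [[K [_ ->]]|[W [/tauGP oW ->]]] /=.
  (* Every [L n] lies in [Hd], so it misses whatever [Hd] misses. *)
  move=> miss; exists 0%N => n _; apply/seteqP; split=> // -[[w c] t] [[[/= pw dc] [Tt _]] Kg].
  by suff : (Hd `&` K) (w, c, t) by rewrite miss.
move=> [[[w c] t] [[[/= pw dc] Tt] Wg]].
have oWt : open [set s | W (w, c, s)].
  apply: (@open_comp _ _ (fun s : R2 => (c, s)) (slice W w)); last exact: oW.
  by move=> s _; apply: continuous_pair; [exact: cvg_cst | exact: cvg_id].
have [|n [n0 [s ns Ws]]] := @roots_of_unity_dense R t [set s | W (w, c, s)] Tt.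
  by apply: open_nbhs_nbhs; split.
(* For [m >= n] the number [n] divides [m!], so the [n]-th root of unity found near [t] belongs to
   every later [L m]. *)
exists n => m nm; exists (w, c, s); split=> //; split=> //.
by apply: rootsU_dvd ns; rewrite dvdn_fact// n0.
Qed.

End Main.

Theorem theorem2 (R : realType) (p k : nat) (hp : prime p) (hk : (0 < k)%N)
  (iota : set (R2_ R * R2_ R) -> R2_ R -> set (R2_ R * R2_ R))
  (hiota : forall F, Cfin k F -> identification k F (iota F)) :
  (* (1) alpha : (F, f) |-> H_{F,f} is a well-defined homeomorphism *)
  homeo (Cfin k `*` dual p) (prod_top (chabauty (CkT k) (@tauCkT R)) (dual_top p))
        (Cdis p k) (chabauty (Gpk p k) (@tauG R))
        (fun Ff => Hff p k iota Ff.1 Ff.2)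
  /\
  (* (2) closure of C^dis in C(G_{p,k}) *)
  closure_in (CG p k) (chabauty (Gpk p k) (@tauG R)) (Cdis p k) =
    Cdis p k `|` [set H | exists d : nat, [/\ leq 1 d, dvdn d k &
                                           H = Cpinf p `*` rootsU d `*` @Tc R]].
Proof.
split; first exact: alpha_homeo.
apply/seteqP; split; first exact: Cdis_closure.
move=> H [dH|[d [d0 dk ->]]]; last exact: rootsU_Tc_closure.
by split=> [|U _ UH]; [case: dH | exists H].
Qed.
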